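(* Let $\xi(s)=\tfrac12 s(s-1)\pi^{-s/2}\Gamma(s/2)\zeta(s)$ be the Riemann xi-function, and fix $(\omega,\nu)\in\mathbb{R}_{>0}\times\mathbb{Z}_{>0}$ with $\omega\nu>1$. Let $K(x)=K_\zeta^{\omega,\nu}(x)$ be the function with $K(x)=0$ for $x<0$ determined by the Fourier integral formula \[ \left(\frac{\xi(s-\omega)}{\xi(s+\omega)}\right)^{\nu}=\int_{-\infty}^{\infty}K(x)e^{izx}\,dx,\qquad s=\tfrac12-iz, \] valid for $z$ in an upper half-plane. For $t\ge 0$ let $\mathsf{K}[t]$ be the operator on $L^2(-\infty,t)$ given by $(\mathsf{K}[t]f)(x)=\mathbf{1}_{(-\infty,t]}(x)\int_{-\infty}^{t}K(x+y)f(y)\,dy$. Let $\tau>0$ be a real number such that $\det(1\pm\mathsf{K}[t])\neq0$ (Fredholm determinants, both signs) for every $0\le t<\tau$. For $0\le t<\tau$ let $\phi^{\pm}(t,\cdot)$ be the unique solutions in $L^2(-\infty,t)$ of \[ \phi^{\pm}(t,x)\pm\int_{-\infty}^{t}K(x+y)\phi^{\pm}(t,y)\,dy=K(x+t), \] and put $m(t)=\det(1+\mathsf{K}[t])/\det(1-\mathsf{K}[t])$. Let $\Phi(t,\cdot)$ and $\Psi(t,\cdot)$ be the unique solutions in $L^2(-\infty,t)$ of \[ \Phi(t,x)+\int_{-\infty}^{t}K(x+y)\Phi(t,y)\,dy=\mathbf{1}_{[-t,t]}(x),\qquad \Psi(t,x)-\int_{-\infty}^{t}K(x+y)\Psi(t,y)\,dy=\mathbf{1}_{[-t,t]}(x).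 \] Then $\Phi(t,x)$ and $\Psi(t,x)$ are continuous functions of $x$; for every $0<t<\tau$ we have $\Phi(t,t):=\lim_{x\to t^-}\Phi(t,x)\neq0$ and $\Psi(t,t):=\lim_{x\to t^-}\Psi(t,x)\neq0$; and for $0<t<\tau$, \[ \phi^+(t,x)=-\frac{1}{\Phi(t,t)}\frac{\partial}{\partial t}\Phi(t,x)=\frac{1}{\Psi(t,t)}\frac{\partial}{\partial x}\Psi(t,x),\qquad \phi^-(t,x)=-\frac{1}{\Phi(t,t)}\frac{\partial}{\partial x}\Phi(t,x)=\frac{1}{\Psi(t,t)}\frac{\partial}{\partial t}\Psi(t,x), \] \[ m(t)=\frac{1}{\Phi(t,t)}=\Psi(t,t). \]
   Context: $\mathbf{1}_A$ denotes the characteristic function of $A\subset\mathbb{R}$. ''$\det$'' denotes the Fredholm determinant. It is known (from earlier work) that $K$ is a real-valued continuous function on $\mathbb{R}$, vanishing on $(-\infty,0)$, of at most exponential growth, continuously differentiable off a discrete set with $|K'|$ locally integrable on $\mathbb{R}$, and that $m$ satisfies $m(t)=\exp\big(\int_0^t(\phi^+(s,s)+\phi^-(s,s))\,ds\big)$ for $t$ in the range where $\det(1\pm\mathsf{K}[t])\ne0$.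
   Formalization: Φ(t,x) and Ψ(t,x) are 0 for x<-t and tend to 1 as x→-t from the right, so they jump at x=-t; continuity in x is stated on (-∞,-t) and on [-t,t), and the derivative formulas for φ^± for all x<t with x≠-t. *)

(* Defs.v *)
From HB Require Import structures.
From mathcomp Require Import all_boot all_order all_algebra.
From mathcomp Require Import all_classical all_reals all_analysis.
From mathcomp Require Import complex.

Set Implicit Arguments.
Unset Strict Implicit.
Unset Printing Implicit Defensive.

Import Order.TTheory GRing.Theory Num.Theory.
Import numFieldNormedType.Exports.

Local Open Scope classical_set_scope.
Local Open Scope ring_scope.
Local Open Scope complex_scope.

Definition cexp (R : realType) (z : R[i]) : R[i] :=
  (expR (complex.Re z) * cos (complex.Im z))
    +i* (expR (complex.Re z) * sin (complex.Im z)).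

(* The principal value of a ^ z; meant for a > 0. *)
Definition rcpow (R : realType) (a : R) (z : R[i]) : R[i] :=
  cexp (z * (ln a)%:C).

Definition cintegrable (R : realType) (D : set R) (f : R -> R[i]) : Prop :=
  (@lebesgue_measure R).-integrable D (fun x => (complex.Re (f x))%:E) /\
  (@lebesgue_measure R).-integrable D (fun x => (complex.Im (f x))%:E).

Definition cintegral (R : realType) (D : set R) (f : R -> R[i]) : R[i] :=
  (\int[@lebesgue_measure R]_(x in D) complex.Re (f x))
    +i* (\int[@lebesgue_measure R]_(x in D) complex.Im (f x)).

(* Euler's integral; it converges exactly for Re s > 0. *)
Definition Gamma_euler (R : realType) (s : R[i]) : R[i] :=
  cintegral `]0, +oo[ (fun x : R => rcpow x (s - 1) * (expR (- x))%:C).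

(* The Dirichlet series; it converges exactly for Re s > 1. *)
Definition zeta_dirichlet (R : realType) (s : R[i]) : R[i] :=
  limn (series (fun n => complex.Re (rcpow (n.+1%:R : R) (- s))))
    +i* limn (series (fun n => complex.Im (rcpow (n.+1%:R : R) (- s)))).

(* The xi-function is entire, while Gamma and zeta are given here only by their
   integral and series.  It is therefore characterised as the analytic
   continuation to the whole plane of the product on Re s > 1; the identity
   theorem makes it unique. *)
Definition is_riemann_xi (R : realType) (xi : R[i] -> R[i]) : Prop :=
  (forall s : R[i], derivable (xi : R[i]^o -> R[i]^o) s 1) /\
  (forall s : R[i], 1 < complex.Re s ->
     xi s = 2^-1 * s * (s - 1) * rcpow (pi : R) (- (s / 2))
            * Gamma_euler (s / 2) * zeta_dirichlet s).

(* The formula determines K almost everywhere only; continuity (part of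
   kernel_regular) selects the pointwise values. *)
Definition fourier_formula (R : realType) (xi : R[i] -> R[i])
    (omega : R) (nu : nat) (K : R -> R) : Prop :=
  exists c : R, forall z : R[i], c < complex.Im z ->
    let s := 2^-1 - 'i * z in
    let f := fun x : R => (K x)%:C * cexp ('i * z * x%:C) in
    cintegrable setT f /\
    (xi (s - omega%:C) / xi (s + omega%:C)) ^+ nu = cintegral setT f.

(* A discrete subset of the line is understood as one without accumulation
   points, i.e. with finitely many points in each bounded interval.  The values
   of derive1 K on S are irrelevant, S being Lebesgue-null. *)
Definition kernel_regular (R : realType) (K : R -> R) : Prop :=
  [/\ continuous K,
      (forall x, x < 0 -> K x = 0),
      (exists A c : R, forall x, `|K x| <= A * expR (c * `|x|)),
      (exists S : set R,
         (forall a b : R, finite_set (S `&` `[a, b])) /\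
         (forall x, ~ S x -> derivable K x 1 /\ {for x, continuous (derive1 K)})) &
      locally_integrable setT (derive1 K)].

Definition in_L2 (R : realType) (D : set R) (f : R -> R) : Prop :=
  measurable_fun D f /\
  (\int[@lebesgue_measure R]_(x in D) (f x ^+ 2)%:E < +oo)%E.

Definition ae_eq_on (R : realType) (D : set R) (f g : R -> R) : Prop :=
  {ae @lebesgue_measure R, forall x, D x -> f x = g x}.

(* The integral operator on L^2(D) with kernel k. *)
Definition integral_op (R : realType) (D : set R) (k : R -> R -> R)
    (f : R -> R) (x : R) : R :=
  \int[@lebesgue_measure R]_(y in D) (k x y * f y).

Definition hankel (R : realType) (K : R -> R) (x y : R) : R := K (x + y).

(* f in L^2(D) solves f + c T f = g in L^2(D), T the operator with kernel k. *)
Definition L2_solution (R : realType) (D : set R) (k : R -> R -> R) (c : R)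
    (g f : R -> R) : Prop :=
  in_L2 D f /\ ae_eq_on D (fun x => f x + c * integral_op D k f x) g.

(* The n-fold iterated integral of F (x_0, ..., x_(n-1)) over D^n. *)
Fixpoint iter_integral (R : realType) (D : set R) (n : nat)
    (F : seq R -> R) : R :=
  if n is m.+1 then
    \int[@lebesgue_measure R]_(x in D)
      iter_integral D m (fun xs : seq R => F (x :: xs))
  else F [::].

(* Fredholm's series for det (1 + c T), T the operator on L^2(D) with kernel k:
   sum over n of c^n / n! times the integral over D^n of det (k(x_i, x_j)).
   For D = ]-oo, t[ and the kernel K(x + y) with K = 0 on the negative half-line,
   the n-th integrand vanishes off [-t, t[^n, so every integral is over a
   bounded set. *)
Definition fredholm_det (R : realType) (D : set R) (k : R -> R -> R)
    (c : R) : R :=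
  limn (series (fun n : nat =>
    c ^+ n / n`!%:R *
    iter_integral D n (fun xs : seq R =>
      \det (\matrix_(i < n, j < n) k (nth 0 xs i) (nth 0 xs j))))).

Definition left_lim (R : realType) (f : R -> R) (t : R) : R :=
  lim (f x @[x --> t^'-]).

(* Main.v *)
Require Import Defs.
From mathcomp Require Import all_boot all_order all_fingroup all_algebra.
From mathcomp Require Import all_classical all_reals all_analysis.
From mathcomp Require Import complex measurable_realfun.
From mathcomp Require Import ring lra zify.

(* On [-tau, t] replace the operator by the Hankel matrix [A = (c h K(x_i + x_j))]
   of a grid of step [h].  Fredholm's series is the limit of [det (1 + A)]: expand
   the latter in principal minors and use Hadamard's inequality to pass to the
   limit.  Hadamard's inequality also bounds [det (1 + A) v] by [sup |(1 + A) v|]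
   (Cramer's rule), which gives in the limit, when the determinant does not vanish,
   an a priori estimate in the sup norm, hence uniqueness and stability in [t].
   As [K] vanishes on the negative half-line, the backward difference [D] satisfies
   [D A = - B D] off the last column, where [B] samples the same kernel at the mid
   points; so [1 + A] with last column replaced by ones has determinant
   [det (1 - B)].  By Cramer's rule [det (1 + c K[t]) Phi(t, t) = det (1 - c K[t])],
   which is the formula for [m].  The derivative in [t] follows from differentiating
   the upper limit of the integral.  For the derivative in [x] one checks backwards that
   [1 + c \int_x^t psi], with [psi] the solution of [psi - c K[t] psi = K(x + t)],
   has a constant image under [1 + c K[t]]. *)

Set Implicit Arguments.
Unset Strict Implicit.
Unset Printing Implicit Defensive.

Import Order.TTheory GRing.Theory Num.Theory.
Import numFieldNormedType.Exports.

Local Open Scope classical_set_scope.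
Local Open Scope ring_scope.

(** * Hadamard's inequality and Cramer's rule *)

(** The determinants are given by Fredholm's series alone, so their link with the integral equation
    has to pass through that series. Finite grids provide it: there Cramer's rule is an identity
    between determinants, free of division. The price is that every bound must be uniform in the
    step [h]. The lower end [- tau] (below, [- T]) is common to all [t]: for [x <= T] and [y < - T]
    one has [K (x + y) = 0], so nothing is lost, and the solutions for different [t] can be
    subtracted on the single interval [[- T, T]]. Since [- T + t < 0], the leading samples of the
    kernel vanish, which makes the matrix identity exact, without a boundary error. The right-hand
    side of the equation for Phi jumps at [- t]; it is replaced by the constant 1, whose solution is
    continuous and represents Phi on [[- t, t[], because for [x <= t] the values below [- t] do not
    enter the integral. The equation is not differentiated in [x], which would put the derivative of
    [K] under the integral; a primitive of [K] is used instead. All this is done for a general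
    factor [c], and [c = 1] and [c = -1] give Phi and Psi. *)

Lemma mul_tr_row (R : comRingType) n (u v : 'rV[R]_n) :
  (u *m v^T) 0 0 = \sum_j u 0 j * v 0 j.
Proof. by rewrite mxE; apply: eq_bigr => j _; rewrite mxE. Qed.

(* A Householder reflection carries [r] onto the first axis. *)
Lemma orthogonal_to_axis (R : rcfType) n (r : 'rV[R]_n.+1) :
  exists H : 'M[R]_n.+1, H *m H^T = 1%:M /\
    r *m H = Num.sqrt (\sum_j r 0 j ^+ 2) *: delta_mx 0 0.
Proof.
set s := \sum_j _; set e := delta_mx 0 0 : 'rV[R]_n.+1.
have s_ge0 : 0 <= s by apply: sumr_ge0 => j _; exact: sqr_ge0.
pose v := r - Num.sqrt s *: e.
have [v0|vn0] := eqVneq v 0.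
  by exists 1%:M; rewrite trmx1 !mulmx1; split=> //; apply/eqP; rewrite -subr_eq0; apply/eqP.
have dotE (u : 'rV[R]_n.+1) : u *m v^T = ((u *m v^T) 0 0)%:M by exact: mx11_scalar.
pose q := (v *m v^T) 0 0.
have qn0 : q != 0.
  apply: contra vn0 => /eqP; rewrite /q mul_tr_row => /eqP.
  rewrite psumr_eq0 => [/allP vz|j _]; last by rewrite -expr2 sqr_ge0.
  apply/eqP/rowP => j; rewrite [RHS]mxE; apply/eqP.
  by have := vz j (mem_index_enum _); rewrite mulf_eq0 orbb.
(* As [r] and [Num.sqrt s *: e] have the same length, [r . v] is half of [v . v]. Hence the
   reflection in the hyperplane orthogonal to [v] sends [r] to [r - v]. *)
have rv : (r *m v^T) 0 0 = q / 2.
  rewrite /q !mul_tr_row.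
  have vE j : v 0 j = r 0 j - Num.sqrt s * (j == 0)%:R by rewrite !mxE eqxx andTb.
  rewrite (eq_bigr (fun j => r 0 j ^+ 2 - Num.sqrt s * (r 0 j * (j == 0)%:R)));
    last by move=> j _; rewrite vE; ring.
  rewrite [in RHS](eq_bigr (fun j => r 0 j ^+ 2 + s * (j == 0)%:R
      - 2 * Num.sqrt s * (r 0 j * (j == 0)%:R)));
    last first.
    move=> j _; rewrite vE; move: (Num.sqrt s) (sqr_sqrtr s_ge0) => w <-.
    by case: (j == 0); rewrite ?mulr1n ?mulr0n; ring.
  rewrite !sumrB big_split/= -!mulr_sumr -/s.
  rewrite [X in s * X](_ : _ = 1); last first.
    by rewrite (bigD1 0)//= big1 ?addr0// => j /negPf ->.
  lra.
pose H := 1%:M - (2 / q) *: (v^T *m v).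
have HT : H^T = H by rewrite /H linearB/= linearZ/= trmx1 trmx_mul trmxK.
exists H; split; last first.
  rewrite /H mulmxBr mulmx1 -scalemxAr mulmxA dotE rv mul_scalar_mx scalerA.
  rewrite (_ : 2 / q * (q / 2) = 1); last by field; rewrite qn0.
  by rewrite scale1r /v subKr.
rewrite HT {1}/H mulmxBl mul1mx {2}/H mulmxBr mulmx1 -scalemxAl -scalemxAr.
rewrite mulmxA -[v^T *m v *m v^T]mulmxA [v *m v^T]dotE -/q mul_mx_scalar.
rewrite -scalemxAl !scalerA /H.
rewrite (_ : 2 / q * (2 / q * q) = 2 / q + 2 / q); last by field; rewrite qn0.
by rewrite scalerDl opprB addrK subrK.
Qed.

(** Induction on the size: an orthogonal matrix on the right preserves the lengths of the rows and
    the square of the determinant, and puts row 0 on the first axis. What remains is a minor whose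
    rows have lost one entry, so their lengths only decrease. *)
Lemma hadamard (R : rcfType) n (M : 'M[R]_n) :
  (\det M) ^+ 2 <= \prod_i \sum_j M i j ^+ 2.
Proof.
elim: n M => [|n IHn] M; first by rewrite det_mx00 big_ord0 expr1n.
have [H [HH rH]] := orthogonal_to_axis (row 0 M).
set s := \sum_j row 0 M 0 j ^+ 2 in rH.
have detH : \det H ^+ 2 = 1 by rewrite expr2 -{2}(det_tr H) -det_mulmx HH det1.
have rowN i : \sum_j (M *m H) i j ^+ 2 = \sum_j M i j ^+ 2.
  transitivity ((M *m H *m (M *m H)^T) i i).
    by rewrite [RHS]mxE; apply: eq_bigr => j _; rewrite [_^T j i]mxE expr2.
  rewrite trmx_mul mulmxA -(mulmxA M) HH mulmx1 mxE.
  by apply: eq_bigr => j _; rewrite [_^T j i]mxE expr2.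
have row0 j : (M *m H) 0 j = Num.sqrt s * (j == 0)%:R.
  have := congr1 (fun A : 'rV_n.+1 => A 0 j) rH.
  by rewrite -row_mul mxE => ->; rewrite !mxE eqxx andTb.
have -> : \det M ^+ 2 = \det (M *m H) ^+ 2 by rewrite det_mulmx exprMn detH mulr1.
rewrite (expand_det_row _ 0) (bigD1 0)//= big1 ?addr0; last first.
  by move=> j jn0; rewrite row0 (negPf jn0) mulr0 mul0r.
rewrite row0 eqxx mulr1 exprMn sqr_sqrtr; last first.
  by apply: sumr_ge0 => j _; exact: sqr_ge0.
rewrite big_ord_recl; apply: ler_pM; rewrite ?sqr_ge0//.
- by apply: sumr_ge0 => j _; exact: sqr_ge0.
- by rewrite /s; apply: ler_sum => j _; rewrite mxE.
rewrite /cofactor exprMn sqrr_sign mul1r; apply: le_trans (IHn _) _.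
apply: ler_prod => i _; apply/andP; split.
  by apply: sumr_ge0 => j _; exact: sqr_ge0.
rewrite -(rowN (lift ord0 i)) [leRHS]big_ord_recl.
rewrite (_ : \sum_(j < n) _ = \sum_(j < n) (M *m H) (lift ord0 i) (lift ord0 j) ^+ 2).
  by rewrite lerDr sqr_ge0.
by apply: eq_bigr => j _; rewrite !mxE.
Qed.

Section ReplaceColumn.
Variables (R : comRingType) (n : nat).

Definition set_col (M : 'M[R]_n) (k : 'I_n) (g : 'cV[R]_n) : 'M[R]_n :=
  \matrix_(i, j) if j == k then g i 0 else M i j.

Lemma det_set_col (M : 'M[R]_n) k g :
  \det (set_col M k g) = \sum_i g i 0 * cofactor M i k.
Proof.
rewrite (expand_det_col _ k); apply: eq_bigr => i _; rewrite mxE eqxx.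
congr (_ * (_ * \det _)); apply/matrixP => a b; rewrite !mxE.
by rewrite eq_sym (negPf (neq_lift _ _)).
Qed.

(** Read off from [\adj M *m M = (\det M)%:M]. The determinant stays on the right as a factor, so
    the rule applies to grids whose determinant is not known to be nonzero. *)
Lemma cramer (M : 'M[R]_n) k (v : 'cV[R]_n) :
  \det (set_col M k (M *m v)) = \det M * v k 0.
Proof.
have := congr1 (fun A : 'cV_n => A k 0) (congr1 (mulmx^~ v) (mul_adj_mx M)).
rewrite /= mul_scalar_mx [in RHS]mxE => <-.
rewrite -mulmxA mxE det_set_col; apply: eq_bigr => i _.
by rewrite [\adj M _ _]mxE mulrC.
Qed.

Lemma det_set_colD (M : 'M[R]_n) k g h :
  \det (set_col M k (g + h)) = \det (set_col M k g) + \det (set_col M k h).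
Proof.
rewrite !det_set_col -big_split; apply: eq_bigr => i _.
by rewrite mxE mulrDl.
Qed.

Lemma det_set_colZ (M : 'M[R]_n) k a g :
  \det (set_col M k (a *: g)) = a * \det (set_col M k g).
Proof.
rewrite !det_set_col mulr_sumr; apply: eq_bigr => i _.
by rewrite mxE mulrA.
Qed.

End ReplaceColumn.

(* With [D] the backward difference and [X] the identity with last column 1,
   [D (1 + A) = (1 - B) D] off the last column, whereas the last column of both
   [D * set_col (1 + A)] and [(1 - B) * D * X] is the first basis vector. *)
Lemma det_hankel_set_col (R : comRingType) n (al : nat -> R) :
  (forall m, (m <= n)%N -> al m = 0) ->
  \det (set_col (1%:M + \matrix_(i < n.+1, j < n.+1) al (i + j).+1) ord_max
          (const_mx 1)) =
  \det (1%:M - \matrix_(i < n.+1, j < n.+1) al (i + j)%N).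
Proof.
move=> al0; set A := \matrix_(i, j) al _; set B := \matrix_(i, j) al (i + j)%N.
pose D : 'M[R]_n.+1 := \matrix_(i, j) ((i == j)%:R - ((i : nat) == j.+1)%:R).
pose X : 'M[R]_n.+1 := set_col 1%:M ord_max (const_mx 1).
have detD : \det D = 1.
  rewrite det_trig; last first.
    apply/is_trig_mxP => i j ij; rewrite mxE.
    by rewrite -val_eqE/= !ltn_eqF ?subrr//= ltnS ltnW.
  by apply: big1 => i _; rewrite mxE eqxx ltn_eqF// subr0.
have detX : \det X = 1.
  rewrite -det_tr det_trig; last first.
    apply/is_trig_mxP => i j ij; rewrite !mxE; case: eqP => [im|_].
      by move: ij; rewrite im/= ltnNge -ltnS ltn_ord.
    by rewrite -val_eqE/= gtn_eqF.
  by apply: big1 => i _; rewrite !mxE; case: ifP; rewrite ?eqxx.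
have DlE (Y : 'M[R]_n.+1) i j : (D *m Y) i j =
    Y i j - (if i == 0 then 0 else Y (inord i.-1) j).
  rewrite mxE (eq_bigr (fun k => (i == k)%:R * Y k j - ((i : nat) == k.+1)%:R * Y k j));
    last by move=> k _; rewrite mxE mulrBl.
  rewrite sumrB; congr (_ - _).
    rewrite (bigD1 i)//= eqxx mul1r big1 ?addr0// => k.
    by rewrite eq_sym => /negPf ->; rewrite mul0r.
  case: ifP => [/eqP ->|i0].
    by apply: big1 => k _; rewrite mul0r.
  have ip : (i.-1 < n.+1)%N by rewrite (leq_ltn_trans (leq_pred _)).
  have igt0 : (0 < i)%N by rewrite lt0n; move/negbT: i0; rewrite -val_eqE.
  rewrite (bigD1 (inord i.-1))//= inordK// prednK// eqxx mul1r big1 ?addr0// => k kn.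
  case: eqP => [ik|_]; last by rewrite mul0r.
  by move: kn; rewrite -val_eqE/= inordK// ik eqxx.
have DrE (Y : 'M[R]_n.+1) i j : (Y *m D) i j =
    Y i j - (if j == ord_max then 0 else Y i (inord j.+1)).
  rewrite mxE (eq_bigr (fun k => Y i k * (k == j)%:R - Y i k * ((k : nat) == j.+1)%:R));
    last by move=> k _; rewrite mxE mulrBr.
  rewrite sumrB; congr (_ - _).
    rewrite (bigD1 j)//= eqxx mulr1 big1 ?addr0// => k.
    by move=> /negPf ->; rewrite mulr0.
  case: ifP => [/eqP ->|i0].
    apply: big1 => k _; rewrite ltn_eqF ?mulr0//=; exact: ltn_ord.
  have jn : (j < n)%N.
    by rewrite ltn_neqAle -ltnS ltn_ord andbT; move/negbT: i0; rewrite -val_eqE.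
  rewrite (bigD1 (inord j.+1))//= inordK// eqxx mulr1 big1 ?addr0// => k kn.
  case: eqP => [ik|_]; last by rewrite mulr0.
  by move: kn; rewrite -val_eqE/= inordK// ik eqxx.
set P := set_col _ _ _.
suff e : D *m P = (1%:M - B) *m (D *m X).
  have := congr1 determinant e; rewrite !det_mulmx detD detX mul1r.
  by rewrite !mulr1.
have DX i j : (D *m X) i j = if j == ord_max then (i == 0)%:R else D i j.
  rewrite DlE !mxE; case: (eqVneq j ord_max) => [_|jm].
    by case: (i == 0); rewrite ?subr0 ?subrr.
  have [->|i0] := eqVneq i 0; first by [].
  congr (_ - _); congr (nat_of_bool _)%:R.
  have igt0 : (0 < i)%N by rewrite lt0n; move: i0; rewrite -val_eqE.
  rewrite -val_eqE/= inordK ?(leq_ltn_trans (leq_pred _))//.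
  by rewrite -{2}(prednK igt0) eqSS.
(* Hence [1 - B] fixes the first basis vector, which is the last column of [D *m X]. *)
have Bi0 (i : 'I_n.+1) : B i 0 = 0 by rewrite mxE addn0 al0// -ltnS ltn_ord.
apply/matrixP => i j; have [->|jm] := eqVneq j ord_max.
  rewrite [RHS]mxE (bigD1 0)//= DX eqxx mulr1 big1 ?addr0; last first.
    by move=> k /negPf k0; rewrite DX eqxx k0 mulr0.
  have -> : (1%:M - B) i 0 = (i == 0)%:R by rewrite mxE [X in _ + X]mxE Bi0 subr0 mxE.
  rewrite DlE !mxE eqxx.
  by case: (i == 0); rewrite ?subr0 ?subrr.
(* Off the last column [A i j - A i.-1 j = B i j.+1 - B i j], both being
   [al (i + j).+1 - al (i + j)]. In row 0, where nothing is subtracted on the left, [al j = 0] makes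
   up for it. *)
transitivity (((1%:M - B) *m D) i j); last first.
  by rewrite !mxE; apply: eq_bigr => k _; rewrite DX (negPf jm).
rewrite mulmxBl mul1mx [in RHS]mxE [X in _ = _ + X]mxE DrE DlE (negPf jm).
rewrite !mxE (negPf jm).
have jn : (j < n)%N.
  by rewrite ltn_neqAle -ltnS ltn_ord andbT; move: jm; rewrite -val_eqE.
rewrite [nat_of_ord (inord j.+1)]inordK//; have [->|i0] := eqVneq i 0.
  by rewrite /= !add0n (al0 j (ltnW jn)) sub0r opprK mulr0n !subr0.
have igt0 : (0 < i)%N by rewrite lt0n; move: i0; rewrite -val_eqE.
have -> : (inord i.-1 == j) = ((i : nat) == j.+1).
  by rewrite -val_eqE/= inordK ?(leq_ltn_trans (leq_pred _))// -{2}(prednK igt0) eqSS.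
rewrite [nat_of_ord (inord i.-1)]inordK ?(leq_ltn_trans (leq_pred _))//.
rewrite -[(i.-1 + j).+1]addSn prednK// addnS.
by rewrite !opprD !opprK; ring.
Qed.

(** * Expansion of [det (1 + A)] in principal minors *)

(** Discrete counterpart of [iter_integral]: over a grid of step [h], and multiplied by [h ^+ n], it
    is a Riemann sum of it. *)
Fixpoint iter_sum (R : nmodType) (I : Type) (v : seq I) (n : nat)
    (F : seq I -> R) : R :=
  if n is m.+1 then \sum_(y <- v) iter_sum v m (fun xs => F (y :: xs))
  else F [::].

Lemma eq_iter_sum (R : nmodType) (I : Type) (v : seq I) n (F G : seq I -> R) :
  (forall xs, size xs = n -> F xs = G xs) -> iter_sum v n F = iter_sum v n G.
Proof.
elim: n F G => [|n IH] F G FG /=; first exact: FG.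
by apply: eq_bigr => y _; apply: IH => xs xsn; apply: FG; rewrite /= xsn.
Qed.

Lemma iter_sum0 (R : nmodType) (I : Type) (v : seq I) n (F : seq I -> R) :
  (forall xs, size xs = n -> F xs = 0) -> iter_sum v n F = 0.
Proof.
elim: n F => [|n IH] F F0 /=; first exact: F0.
by apply: big1 => y _; apply: IH => xs xsn; apply: F0; rewrite /= xsn.
Qed.

Lemma iter_sumZ (R : pzSemiRingType) (I : Type) (v : seq I) n a (F : seq I -> R) :
  iter_sum v n (fun xs => a * F xs) = a * iter_sum v n F.
Proof.
elim: n F => [|n IH] F //=.
by rewrite mulr_sumr; apply: eq_bigr => y _; rewrite IH.
Qed.

Section MinorExpansion.
Variables (R : comNzRingType) (I : Type) (x0 : I) (k : I -> I -> R).

Definition gram_det n (g : nat -> I) : R := \det (\matrix_(i < n, j < n) k (g i) (g j)).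

Definition gram_det_seq (u : seq I) : R := gram_det (size u) (nth x0 u).

Lemma gram_det_perm n (g g' : nat -> I) (s : 'S_n) :
  (forall i : 'I_n, g' i = g (s i)) -> gram_det n g' = gram_det n g.
Proof.
move=> gg'; rewrite /gram_det.
have -> : \matrix_(i < n, j < n) k (g' i) (g' j) =
    row_perm s (col_perm s (\matrix_(i < n, j < n) k (g i) (g j))).
  by apply/matrixP => i j; rewrite !mxE !gg'.
rewrite row_permE det_mulmx det_perm -[\det (col_perm _ _)]det_tr tr_col_perm.
by rewrite row_permE det_mulmx det_perm det_tr mulrA -expr2 sqrr_sign mul1r.
Qed.

Let nth_cat0 u x w : nth x0 (u ++ x :: w) (size u) = x.
Proof. by rewrite nth_cat ltnn subnn. Qed.

Let nth_cat1 u x y w : nth x0 (u ++ [:: x, y & w]) (size u).+1 = y.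
Proof. by rewrite nth_cat ltnNge leqnSn subSnn. Qed.

Lemma gram_det_repeat u x w : gram_det_seq (u ++ [:: x, x & w]) = 0.
Proof.
rewrite /gram_det_seq size_cat/=.
have i0 : (size u < size u + (size w).+2)%N by rewrite -{1}[size u]addn0 ltn_add2l.
have i1 : ((size u).+1 < size u + (size w).+2)%N by rewrite !addnS !ltnS leq_addr.
apply: (@determinant_alternate _ _ _ (Ordinal i0) (Ordinal i1)) => [|j].
  by rewrite -val_eqE/= ltn_eqF.
by rewrite !mxE/= nth_cat0 nth_cat1.
Qed.

Lemma gram_det_swap u x y w :
  gram_det_seq (u ++ [:: x, y & w]) = gram_det_seq (u ++ [:: y, x & w]).
Proof.
rewrite /gram_det_seq !size_cat/=.
have i0 : (size u < size u + (size w).+2)%N by rewrite -{1}[size u]addn0 ltn_add2l.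
have i1 : ((size u).+1 < size u + (size w).+2)%N by rewrite !addnS !ltnS leq_addr.
apply: (gram_det_perm (s := tperm (Ordinal i0) (Ordinal i1))) => i.
case: tpermP => [->|->|] /=.
- by rewrite nth_cat0 nth_cat1.
- by rewrite nth_cat0 nth_cat1.
move=> /eqP + /eqP; rewrite -!val_eqE/= !nth_cat => n0 n1.
case: ltnP => // ui; have [d dE] : exists d, (i = size u + d.+2 :> nat)%N.
  exists (i - (size u).+2)%N.
  by move: ui n0 n1; case: (nat_of_ord i) => [|[|j]]; lia.
by rewrite dE addKn.
Qed.

Definition minor_sum n u v := iter_sum v n (fun xs => gram_det_seq (u ++ xs)).

Lemma minor_sumS n u v :
  minor_sum n.+1 u v = \sum_(y <- v) minor_sum n (rcons u y) v.
Proof.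
apply: eq_bigr => y _; apply: eq_iter_sum => xs _; by rewrite cat_rcons.
Qed.

(* Minors with a repeated index vanish, so [x] occurs at most once, at any of
   [n.+1] places. *)
Lemma minor_sum_cons n u x v :
  minor_sum n.+1 u (x :: v) =
  minor_sum n.+1 u v + minor_sum n (rcons u x) v *+ n.+1.
Proof.
elim: n u => [|n IH] u; first by rewrite !minor_sumS big_cons addrC.
rewrite minor_sumS big_cons IH (_ : minor_sum n _ v = 0) ?mul0rn ?addr0; last first.
  apply: iter_sum0 => xs _; rewrite -[rcons (rcons _ _) _]cats1 -cats1.
  by rewrite -!catA gram_det_repeat.
rewrite (eq_bigr _ (fun y _ => IH (rcons u y))) big_split/= -minor_sumS.
rewrite addrCA; congr (_ + _); rewrite mulrS; congr (_ + _).
rewrite [minor_sum n.+1 (rcons u x) v]minor_sumS -sumrMnl.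
apply: eq_bigr => y _; congr (_ *+ _); apply: eq_iter_sum => xs _.
by rewrite -!cats1 -!catA gram_det_swap.
Qed.

(** Interpolates between the minor of [k] ([k0 = n]) and [det (1 + k)] ([k0 = 0]): the identity is
    added from row [k0] on. *)
Definition bordered_det n k0 (g : nat -> I) : R :=
  \det (\matrix_(i < n, j < n) (k (g i) (g j) + ((i == j) && (k0 <= i)%N)%:R)).

(** Linearity in row [k0], split into the unit row and the row of [k]. Expanding along the unit row
    deletes the index [k0], whence [bump]. *)
Lemma bordered_detS n k0 g : (k0 <= n)%N ->
  bordered_det n.+1 k0 g =
  bordered_det n k0 (g \o bump k0) + bordered_det n.+1 k0.+1 g.
Proof.
rewrite -ltnS => k0n; pose i0 := Ordinal k0n.
pose C := \matrix_(i < n.+1, j < n.+1)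
  if i == i0 then (i == j)%:R else k (g i) (g j) + ((i == j) && (k0 <= i)%N)%:R.
rewrite /bordered_det.
rewrite (@determinant_multilinear _ _ _ C (\matrix_(i < n.+1, j < n.+1)
    (k (g i) (g j) + ((i == j) && (k0.+1 <= i)%N)%:R)) i0 1 1).
- rewrite !mul1r; congr (_ + _).
  rewrite (expand_det_row _ i0) (bigD1 i0)//= big1 ?addr0; last first.
    by move=> j /negPf ji; rewrite mxE eqxx eq_sym ji mul0r.
  rewrite mxE !eqxx mul1r /cofactor -signr_odd addnn odd_double mul1r.
  congr (\det _); apply/matrixP => i j; rewrite !mxE eq_sym (negPf (neq_lift _ _)).
  congr (_ + (_ && _)%:R); first by rewrite (inj_eq lift_inj).
  by rewrite /= /bump; lia.
- apply/rowP => j; rewrite !mxE eqxx !mul1r leqnn ltnn andbT andbF/= addr0.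
  by rewrite addrC.
- apply/matrixP => i j; rewrite !mxE.
  by rewrite eq_sym (negPf (neq_lift _ _)).
- apply/matrixP => i j; rewrite !mxE; congr (_ + (_ && _)%:R).
  by rewrite /= ltn_neqAle neq_bump.
Qed.

(** Each element of [v] is either deleted or moved to the selected list [u]. The sequence [inv]
    stands for 1/n!; its recurrence absorbs the multiplicity [n.+1] of [minor_sum_cons]. Any cutoff
    [m] beyond the size of [v] will do, as longer tuples repeat an index. *)
Lemma bordered_det_minor_sum u v m : (size v < m)%N ->
  forall (inv : nat -> R), (forall n, inv n.+1 *+ n.+1 = inv n) ->
  inv 0%N * bordered_det (size (u ++ v)) (size u) (nth x0 (u ++ v)) =
  \sum_(n < m) inv n * minor_sum n u v.
Proof.
elim: v u m => [|x v IH] u [//|m] sv inv invS.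
  rewrite cats0 big_ord_recl big1 ?addr0; last first.
    by move=> i _; rewrite /= minor_sumS big_nil mulr0.
  congr (_ * _); rewrite /minor_sum/= cats0 /gram_det_seq/gram_det/bordered_det.
  congr (\det _); apply/matrixP => i j; rewrite !mxE.
  by rewrite leqNgt ltn_ord andbF addr0.
rewrite size_cat/= addnS bordered_detS ?leq_addr// mulrDr.
rewrite big_ord_recl (eq_bigr (fun i : 'I_m => inv i.+1 * minor_sum i.+1 u v +
   inv i * minor_sum i (rcons u x) v)); last first.
  move=> i _; rewrite /= minor_sum_cons mulrDr; congr (_ + _).
  by rewrite -(invS i) mulrnAr mulrnAl.
rewrite big_split/= addrA; congr (_ + _).
  rewrite -size_cat -[in RHS]/(minor_sum 0 u v).
  have := IH u m.+1 (ltnW sv) inv invS; rewrite big_ord_recl/= => <-.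
  congr (_ * _); congr (\det _); apply/matrixP => i j; rewrite !mxE.
  have nthE (l : 'I_(size (u ++ v))) :
      nth x0 (u ++ x :: v) (bump (size u) l) = nth x0 (u ++ v) l.
    rewrite !nth_cat /bump; have [ul|ul] := leqP (size u) l.
      by rewrite [(true + l)%N]add1n ltnNge (leq_trans ul)//= subSn.
    by rewrite [(false + l)%N]add0n ul.
  by rewrite /= !nthE.
have := IH (rcons u x) m sv inv invS; rewrite cat_rcons size_rcons => <-.
by rewrite size_cat/= addnS.
Qed.

End MinorExpansion.

(** The finite form of Fredholm's series. The tuples are ordered, so each principal minor of size n
    occurs n! times. *)
Lemma det_add1_minor_sum (R : numFieldType) (I : Type) (x0 : I)
    (k : I -> I -> R) (v : seq I) m : (size v < m)%N ->
  \det (1%:M + \matrix_(i < size v, j < size v) k (nth x0 v i) (nth x0 v j)) =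
  \sum_(n < m) n`!%:R^-1 * iter_sum v n (fun xs => gram_det k n (nth x0 xs)).
Proof.
move=> sv.
have := @bordered_det_minor_sum R I x0 k [::] v m sv (fun n => n`!%:R^-1).
rewrite /= fact0 invr1 mul1r => H.
transitivity (bordered_det k (size v) 0 (nth x0 v)).
  congr (\det _); apply/matrixP => i j; rewrite !mxE.
  by rewrite leq0n andbT addrC.
rewrite H => [|n]; last first.
  by rewrite factS natrM invfM -mulrnAl -mulr_natr mulVf ?mul1r// pnatr_eq0.
apply: eq_bigr => n _; congr (_ * _); apply: eq_iter_sum => xs xsn.
by rewrite /gram_det_seq xsn.
Qed.

Lemma gram_det_bound (R : realType) (k : R -> R -> R) (M : R) n (g : nat -> R) :
  (forall x y, `|k x y| <= M) -> gram_det k n g ^+ 2 <= (n%:R * M ^+ 2) ^+ n.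
Proof.
move=> kM; apply: le_trans (hadamard _) _.
rewrite -[X in _ <= _ ^+ X]card_ord -prodr_const; apply: ler_prod => i _.
rewrite sumr_ge0//=; last by move=> j _; rewrite sqr_ge0.
rewrite mulr_natl -[X in _ <= _ *+ X]card_ord -sumr_const; apply: ler_sum => j _.
by rewrite mxE -real_normK ?num_real// lerXn2r// nnegrE// (le_trans _ (kM 0 0)).
Qed.

(* Hadamard's bound, after scaling the replaced column by [sqrt h]: the row
   through the replaced diagonal entry then has norm [O(sqrt h)]. *)
Lemma det_set_col_bound (R : realType) (M L h : R) N (A : 'M[R]_N) k (g : 'cV[R]_N) :
  0 < h -> N%:R * h = L -> (forall i j, `|A i j| <= h * M) ->
  (forall i, `|g i 0| <= 1) ->
  \det (set_col (1%:M + A) k g) ^+ 2 <=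
  (1 + L * M ^+ 2) * expR (L * (1 + 2 * M + 2 * L * M ^+ 2)).
Proof.
move=> h0 NhL AM g1.
have N0 : (0 < N)%N by case: N A k g NhL AM g1 => // ? [].
have L0 : 0 <= L by rewrite -NhL mulr_ge0// ltW.
have hL : h <= L by rewrite -NhL -[leLHS]mul1r ler_pM2r// ler1n.
have M0 : 0 <= M by rewrite -(pmulr_rge0 _ h0) (le_trans _ (AM k k)).
have A2 i j : A i j ^+ 2 <= h ^+ 2 * M ^+ 2.
  by rewrite -exprMn -real_normK ?num_real// lerXn2r// nnegrE mulr_ge0// ltW.
have g2 i : g i 0 ^+ 2 <= 1.
  by rewrite -real_normK ?num_real// expr_le1.
(* Each row other than [k] has squared length at most [1 + h * K]: the replaced column gives [h],
   the diagonal entry [1 + 2 * h * M], and the squares of the entries of [A] sum to at most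
   [h * L * M ^+ 2]. The product of N such factors stays below [expR (L * K)]. *)
set K := 1 + 2 * M + _.
rewrite -(ler_pM2l h0) -{1}[h](sqr_sqrtr (ltW h0)) -exprMn -det_set_colZ.
apply: le_trans (hadamard _) _.
rewrite (bigD1 k)//= mulrA; apply: ler_pM.
- by apply: sumr_ge0 => j _; exact: sqr_ge0.
- by apply: prodr_ge0 => i _; apply: sumr_ge0 => j _; exact: sqr_ge0.
- rewrite (bigD1 k)//= mxE eqxx mxE exprMn sqr_sqrtr ?(ltW h0)// mulrDr mulr1.
  apply: lerD; first by rewrite ler_piMr// ltW.
  rewrite (_ : h * _ = \sum_(j < N) (h ^+ 2 * M ^+ 2)); last first.
    by rewrite sumr_const card_ord -mulr_natl -NhL; ring.
  rewrite [leRHS](bigD1 k)//= -[leLHS]add0r lerD ?mulr_ge0 ?exprn_ge0 ?(ltW h0)//.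
  apply: ler_sum => j jk; rewrite mxE (negPf jk) mxE mxE eq_sym (negPf jk) add0r.
  exact: A2.
rewrite (_ : expR _ = \prod_(i < N) expR (h * K)); last first.
  by rewrite prodr_const card_ord -expRM_natl -NhL mulrA.
rewrite [leRHS](bigD1 k)//= -[leLHS]mul1r ler_pM//.
- by apply: prodr_ge0 => i _; apply: sumr_ge0 => j _; exact: sqr_ge0.
- rewrite -expR0 ler_expR mulr_ge0 ?(ltW h0)// /K !addr_ge0 ?mulr_ge0 ?sqr_ge0//.
apply: ler_prod => i ik; rewrite sumr_ge0//=; last by move=> j _; rewrite sqr_ge0.
apply: le_trans (expR_ge1Dx _).
rewrite (bigD1 k)//= mxE eqxx mxE exprMn sqr_sqrtr ?(ltW h0)//.
apply: (@le_trans _ _ (h + \sum_(j < N) ((i == j)%:R * (1 + 2 * (h * M)) + h ^+ 2 * M ^+ 2))).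
  apply: lerD; first by rewrite ler_piMr// ltW.
  rewrite [leRHS](bigD1 k)//= -[leLHS]add0r; apply: lerD.
    by rewrite (negPf ik) mul0r add0r mulr_ge0 ?sqr_ge0.
  apply: ler_sum => j jk; rewrite mxE (negPf jk) mxE mxE.
  case: (i == j); rewrite ?mulr1n ?mulr0n ?mul0r ?mul1r ?add0r//.
  have := A2 i j; have := AM i j; rewrite ler_norml => /andP[_].
  by rewrite sqrrD expr1n mul1r -mulr_natl => ? ?; lra.
rewrite big_split/= sumr_const card_ord -mulr_suml.
rewrite (bigD1 i)//= eqxx big1 ?addr0; last by move=> j /negPf; rewrite eq_sym => ->.
rewrite -[_ *+ N]mulr_natl (_ : N%:R * (h ^+ 2 * M ^+ 2) = h * (L * M ^+ 2)); last first.
  by rewrite -NhL; ring.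
have : 0 <= h * (L * M ^+ 2) by rewrite !mulr_ge0 ?sqr_ge0// ltW.
rewrite mulr1n mul1r /K; lra.
Qed.

(** * Integrals of continuous functions *)

Section Integral.
Variable R : realType.
Implicit Types (f g : R -> R) (a b x y : R).
Notation mu := (@lebesgue_measure R).

Lemma continuousP_eps f : continuous f <->
  forall x (e : R), 0 < e -> exists d : R, 0 < d /\ forall y, `|x - y| < d -> `|f x - f y| <= e.
Proof.
split=> [cf x e e0|H x].
  have /cvgrPdist_le/(_ e e0)/nbhs_ballP[d /= d0 H] := cf x.
  by exists d; split=> // y xy; exact: H.
apply/cvgrPdist_le => e e0; have [d [d0 Hd]] := H x e e0.
by apply/nbhs_ballP; exists d => //= y; exact: Hd.
Qed.

(** Only [x] is confined to the interval; [y] may leave it, which serves difference quotients at the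
    end points. *)
Lemma heine_cantor f a b : continuous f -> forall e : R, 0 < e ->
  exists d : R, 0 < d /\
    forall x y, a <= x <= b -> `|x - y| < d -> `|f x - f y| <= e.
Proof.
move=> /continuousP_eps cf e e0.
have e20 : 0 < e / 2 by rewrite divr_gt0.
have := @segment_compact R a b; rewrite compact_near_coveringP.
move=> /(_ _ (0 : R)^'+ (fun d x => forall y, `|x - y| < d -> `|f x - f y| <= e)) H.
have {}H : \forall d \near (0:R)^'+, `[a, b]%classic `<=`
    (fun x => forall y, `|x - y| < d -> `|f x - f y| <= e).
  apply: H => x _; have [d [d0 Hd]] := cf x _ e20.
  have d20 : 0 < d / 2 by rewrite divr_gt0.
  exists (ball x (d / 2), [set d' | d' < d / 2]) => /=.
    split; first by apply: nbhsx_ballx.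
    by apply: nbhs_right_lt.
  move=> [x' d'] [/= xx' dd'] y x'y.
  rewrite -(subrK (f x) (f x')) -addrA (le_trans (ler_normD _ _))//.
  rewrite [leRHS]splitr lerD//.
    by rewrite distrC Hd// (lt_trans xx')// ltr_pdivrMr// ltr_pMr// ltr1n.
  apply: Hd; rewrite -(subrK x' x) -addrA (le_lt_trans (ler_normD _ _))//.
  by rewrite [ltRHS]splitr ltrD// (lt_trans x'y).
near (0:R)^'+ => d; exists d; split; first by near: d; exact: nbhs_right_gt.
by move=> x y xab; apply: (near H d).
Unshelve. all: by end_near. Qed.

Lemma continuous_bounded f a b : continuous f ->
  exists M : R, 0 <= M /\ forall x, a <= x <= b -> `|f x| <= M.
Proof.
move=> cf; have [ab|ba] := leP a b; last first.
  by exists 0; split=> // x /andP[ax xb]; move: (le_lt_trans (le_trans ax xb) ba); rewrite ltxx.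
have cn : {within `[a, b], continuous (fun x => `|f x|)}.
  apply: continuous_subspaceT => x; apply: (@continuous_comp _ _ _ f (fun y : R => `|y|)).
    exact: cf.
  exact: norm_continuous.
have [c cab H] := EVT_max ab cn.
by exists `|f c|; split=> // x xab; apply: H; rewrite in_itv.
Qed.

Lemma continuous_integrable f a b : continuous f ->
  mu.-integrable `[a, b] (EFin \o f).
Proof.
move=> cf; apply: continuous_compact_integrable; first exact: segment_compact.
exact: continuous_subspaceT.
Qed.

Lemma int_split f a b c : continuous f -> a <= b -> b <= c ->
  \int[mu]_(x in `[a, c]) f x =
  \int[mu]_(x in `[a, b]) f x + \int[mu]_(x in `[b, c]) f x.
Proof.
move=> cf ab bc.
have := @Rintegral_itvB R f (BLeft a) (BRight c) b (continuous_integrable _ _ cf).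
rewrite !bnd_simp => /(_ ab bc); rewrite Rintegral_itv_obnd_cbnd => [<-|].
  by rewrite addrC subrK.
apply: integrableS (continuous_integrable b c cf) => //.
by apply: subset_itvr; rewrite bnd_simp.
Qed.

Lemma intD f g a b : continuous f -> continuous g ->
  \int[mu]_(x in `[a, b]) (f x + g x) =
  \int[mu]_(x in `[a, b]) f x + \int[mu]_(x in `[a, b]) g x.
Proof. by move=> cf cg; rewrite RintegralD//; exact: continuous_integrable. Qed.

Lemma intB f g a b : continuous f -> continuous g ->
  \int[mu]_(x in `[a, b]) (f x - g x) =
  \int[mu]_(x in `[a, b]) f x - \int[mu]_(x in `[a, b]) g x.
Proof. by move=> cf cg; rewrite RintegralB//; exact: continuous_integrable. Qed.

Lemma intZ f a b c : continuous f ->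
  \int[mu]_(x in `[a, b]) (c * f x) = c * \int[mu]_(x in `[a, b]) f x.
Proof. by move=> cf; rewrite RintegralZl//; exact: continuous_integrable. Qed.

Lemma eq_int f g a b : (forall x, a <= x <= b -> f x = g x) ->
  \int[mu]_(x in `[a, b]) f x = \int[mu]_(x in `[a, b]) g x.
Proof. by move=> fg; apply: eq_Rintegral => x; rewrite inE/= in_itv/= => /fg. Qed.

Lemma int_cst a b c : a <= b -> \int[mu]_(x in `[a, b]) c = c * (b - a).
Proof.
move=> ab; rewrite Rintegral_cst//= lebesgue_measure_itv/= lte_fin.
by case: ltP => //= ba; congr (_ * _); apply/esym/eqP; rewrite subr_eq0 eq_le ab ba.
Qed.

Lemma int_bound f a b M : continuous f -> a <= b ->
  (forall x, a <= x <= b -> `|f x| <= M) ->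
  `|\int[mu]_(x in `[a, b]) f x| <= M * (b - a).
Proof.
move=> cf ab fM; apply: le_trans (le_normr_Rintegral _ (continuous_integrable _ _ cf)) _ => //.
rewrite -int_cst//; apply: le_Rintegral => //.
- by apply: integrable_norm => //; exact: continuous_integrable.
by apply: continuous_integrable => x; exact: cvg_cst.
Qed.

Lemma int_approx f a b q e : continuous f -> a <= b ->
  (forall x, a <= x <= b -> `|f x - q| <= e) ->
  `|\int[mu]_(x in `[a, b]) f x - (b - a) * q| <= e * (b - a).
Proof.
move=> cf ab fe; rewrite [_ * q]mulrC -int_cst// -intB//; last by move=> x; exact: cvg_cst.
apply: int_bound => // x; apply: cvgB; [exact: cf|exact: cvg_cst].
Qed.

(** The numbers [q i] need not be values of [f]: for iterated integrals they are themselves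
    lower-dimensional sums. *)
Lemma riemann_sum f a h q e N : continuous f -> 0 <= h ->
  (forall i, (i < N)%N -> forall x, a + i%:R * h <= x <= a + i.+1%:R * h ->
     `|f x - q i| <= e) ->
  `|\int[mu]_(x in `[a, a + N%:R * h]) f x - \sum_(i < N) h * q i| <= e * (N%:R * h).
Proof.
move=> cf h0; elim: N => [|N IH] H.
  by rewrite mul0r addr0 set_itv1 Rintegral_set1 big_ord0 subrr normr0 mulr0.
rewrite (@int_split _ _ (a + N%:R * h)) ?lerDl ?mulr_ge0 ?lerD2l ?ler_wpM2r ?ler_nat//.
rewrite big_ord_recr/= opprD addrACA -(natr1 N) mulrDl mul1r mulrDr.
apply: le_trans (ler_normD _ _) _; apply: lerD.
  by apply: IH => i iN; apply: H; rewrite ltnS ltnW.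
set c := a + N%:R * h; rewrite (_ : a + (N%:R * h + h) = c + h); last by rewrite addrA.
have := @int_approx f c (c + h) (q N) e cf.
rewrite (_ : c + h - c = h); last by rewrite addrC addKr.
apply; first by rewrite lerDl.
by move=> x xx; apply: H => //; rewrite -(natr1 N) mulrDl mul1r addrA.
Qed.

End Integral.

(** * Riemann sums of iterated integrals *)

Section IterIntegral.
Variable R : realType.
Implicit Types (F G : seq R -> R) (a b : R) (D : set R).
Notation mu := (@lebesgue_measure R).

Lemma eq_iter_integral D n F G :
  (forall xs, size xs = n -> (forall i, (i < n)%N -> D (nth 0 xs i)) -> F xs = G xs) ->
  iter_integral D n F = iter_integral D n G.
Proof.
elim: n F G => [|n IH] F G FG /=; first exact: FG.
apply: eq_Rintegral => x /set_mem Dx; apply: IH => xs xsn Dxs.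
by apply: FG => [|[|i]]/=; rewrite ?xsn//; exact: Dxs.
Qed.

Lemma iter_integral0 D n F :
  (forall xs, size xs = n -> (forall i, (i < n)%N -> D (nth 0 xs i)) -> F xs = 0) ->
  iter_integral D n F = 0.
Proof.
elim: n F => [|n IH] F F0 /=; first exact: F0.
rewrite (@eq_Rintegral _ _ _ _ _ (fun=> 0)); first by rewrite /Rintegral integral0.
move=> x /set_mem Dx; apply: IH => xs xsn Dxs.
by apply: F0 => [|[|i]]/=; rewrite ?xsn//; exact: Dxs.
Qed.

(** As soon as one variable leaves [D'], the integrand vanishes for all values of the remaining
    ones, and so does the inner integral. *)
Lemma iter_integral_restrict D D' n F : D' `<=` D ->
  (forall xs, size xs = n -> (forall i, (i < n)%N -> D (nth 0 xs i)) ->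
     forall i, (i < n)%N -> ~ D' (nth 0 xs i) -> F xs = 0) ->
  iter_integral D n F = iter_integral D' n F.
Proof.
move=> D'D; elim: n F => [//|n IH] F H /=.
rewrite Rintegral_mkcond [RHS]Rintegral_mkcond; congr (Rintegral _ _ _).
apply/funext => x; rewrite !patchE.
case: ifPn => [/set_mem Dx|/negP nDx]; last first.
  by case: ifPn => // /set_mem /D'D /mem_set /nDx.
have Hx xs i : size xs = n -> (forall i, (i < n)%N -> D (nth 0 xs i)) -> (i < n.+1)%N ->
    ~ D' (nth 0 (x :: xs) i) -> F (x :: xs) = 0.
  move=> xsn Dxs iN; apply: H => //=; first by rewrite xsn.
  by case=> [|j] //=; exact: Dxs.
case: ifPn => [/set_mem D'x|/negP nD'x].
  by apply: IH => xs xsn Dxs i iN; apply: (Hx _ i.+1).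
apply: iter_integral0 => xs xsn Dxs; apply: (Hx _ 0%N) => //= D'x.
by apply: nD'x; exact: mem_set.
Qed.

(** Sup distance on lists of length [n]. The modulus is global, without an interval for the entries,
    so kernels will first be made uniformly continuous on the whole line. *)
Definition seq_modulus n F (d e : R) :=
  forall xs ys, size xs = n -> size ys = n ->
    (forall i, (i < n)%N -> `|nth 0 xs i - nth 0 ys i| <= d) -> `|F xs - F ys| <= e.

Definition seq_unif_continuous n F :=
  forall e : R, 0 < e -> exists d : R, 0 < d /\ seq_modulus n F d e.

Lemma seq_modulus_cons n F d e x : 0 <= d ->
  seq_modulus n.+1 F d e -> seq_modulus n (fun xs => F (x :: xs)) d e.
Proof.
move=> d0 H xs ys xsn ysn xys; apply: H => [||[|i]]//=.
- by rewrite xsn.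
- by rewrite ysn.
- by rewrite subrr normr0.
- exact: xys.
Qed.

Lemma seq_unif_continuous_cons n F x :
  seq_unif_continuous n.+1 F -> seq_unif_continuous n (fun xs => F (x :: xs)).
Proof.
move=> H e /H[d [d0 Hd]]; exists d; split=> //.
by apply: seq_modulus_cons => //; exact: ltW.
Qed.

Lemma iter_integral_close a b n F G e : a <= b ->
  seq_unif_continuous n F -> seq_unif_continuous n G ->
  (forall xs, size xs = n -> `|F xs - G xs| <= e) ->
  `|iter_integral `[a, b] n F - iter_integral `[a, b] n G| <= e * (b - a) ^+ n.
Proof.
move=> ab; elim: n F G e => [|n IH] F G e cF cG FG /=.
  by rewrite expr0 mulr1; exact: FG.
(* To subtract the outer integrals, the inner ones must be continuous in the first variable. This is
   the induction hypothesis applied to two values of that variable. *)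
have cont H : seq_unif_continuous n.+1 H ->
    continuous (fun x => iter_integral `[a, b] n (fun xs => H (x :: xs))).
  move=> cH; apply/continuousP_eps => x e' e'0.
  have p0 : 0 < (b - a) ^+ n + 1 by rewrite ltr_wpDl ?exprn_ge0 ?subr_ge0.
  have [|d [d0 Hd]] := cH (e' / ((b - a) ^+ n + 1)); first by rewrite divr_gt0.
  exists d; split=> // y xy; apply: le_trans (IH _ _ (e' / ((b - a) ^+ n + 1)) _ _ _) _.
  - exact: seq_unif_continuous_cons.
  - exact: seq_unif_continuous_cons.
  - move=> xs xsn; apply: Hd => [||[|i] _]/=; rewrite ?xsn//; first exact: ltW.
    by rewrite subrr normr0 ltW.
  - by rewrite -mulrA ler_piMr// ?(ltW e'0)// ler_pdivrMl// mulr1 lerDl.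
rewrite -intB; [|exact: cont|exact: cont].
rewrite exprSr mulrA; apply: int_bound => //.
  by move=> x; apply: cvgB; apply: cont.
move=> x _; apply: IH; [exact: seq_unif_continuous_cons|exact: seq_unif_continuous_cons|].
by move=> xs xsn; apply: FG; rewrite /= xsn.
Qed.

Lemma iter_integral_cons_close a b n F d e x y : a <= b -> 0 <= d ->
  seq_unif_continuous n.+1 F -> seq_modulus n.+1 F d e -> `|x - y| <= d ->
  `|iter_integral `[a, b] n (fun xs => F (x :: xs)) -
    iter_integral `[a, b] n (fun xs => F (y :: xs))| <= e * (b - a) ^+ n.
Proof.
move=> ab d0 cF Fd xy; apply: iter_integral_close => //.
- exact: seq_unif_continuous_cons.
- exact: seq_unif_continuous_cons.
- move=> xs xsn; apply: Fd => [||[|i] _]/=; rewrite ?xsn//.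
  by rewrite subrr normr0.
Qed.

Lemma continuous_iter_integral a b n F : a <= b -> seq_unif_continuous n.+1 F ->
  continuous (fun x => iter_integral `[a, b] n (fun xs => F (x :: xs))).
Proof.
move=> ab cF; apply/continuousP_eps => x e e0.
have p0 : 0 < (b - a) ^+ n + 1 by rewrite ltr_wpDl ?exprn_ge0 ?subr_ge0.
have [|d [d0 Hd]] := cF (e / ((b - a) ^+ n + 1)); first by rewrite divr_gt0.
exists d; split=> // y xy.
apply: le_trans (iter_integral_cons_close ab (ltW d0) cF Hd (ltW xy)) _.
by rewrite -mulrA ler_piMr// ?(ltW e0)// ler_pdivrMl// mulr1 lerDl.
Qed.

Lemma iter_integral_co_cc a b n F : a <= b -> seq_unif_continuous n F ->
  iter_integral `[a, b[ n F = iter_integral `[a, b] n F.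
Proof.
move=> ab; elim: n F => [//|n IH] F cF /=.
transitivity (\int[mu]_(x in `[a, b[) iter_integral `[a, b] n (fun xs => F (x :: xs))).
  by apply: eq_Rintegral => x _; apply: IH; exact: seq_unif_continuous_cons.
rewrite Rintegral_itv_bndo_bndc//.
apply: integrableS (continuous_integrable a b (continuous_iter_integral ab cF)) => //.
by apply: subset_itvl; rewrite bnd_simp.
Qed.

Definition grid (p : nat -> R) N := [seq p i | i <- iota 0 N].

Lemma size_grid p N : size (grid p N) = N.
Proof. by rewrite size_map size_iota. Qed.

Lemma nth_grid p N i : (i < N)%N -> nth 0 (grid p N) i = p i.
Proof. by move=> iN; rewrite (nth_map 0%N) ?size_iota// nth_iota. Qed.

(** Each of the [n] variables, when discretized, costs [e] times the volume. The sample [p i] is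
    arbitrary in its cell: right end points and mid points are both needed. *)
Lemma iter_sum_riemann a (h : R) N n F (p : nat -> R) (d e : R) :
  0 <= h -> h <= d -> seq_unif_continuous n F -> seq_modulus n F d e ->
  (forall i, (i < N)%N -> a + i%:R * h <= p i <= a + i.+1%:R * h) ->
  `|iter_integral `[a, a + N%:R * h] n F - h ^+ n * iter_sum (grid p N) n F| <=
  n%:R * e * (N%:R * h) ^+ n.
Proof.
move=> h0 hd cF Fd pP; have d0 := le_trans h0 hd.
have ab : a <= a + N%:R * h by rewrite lerDl mulr_ge0.
elim: n F cF Fd => [|n IH] F cF Fd /=; first by rewrite !expr0 !mul1r subrr normr0 mul0r.
set J := fun x => iter_integral _ n (fun xs => F (x :: xs)).
pose q i := h ^+ n * iter_sum (grid p N) n (fun xs => F (p i :: xs)).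
rewrite (_ : h ^+ n.+1 * _ = \sum_(i < N) h * q i); last first.
  rewrite big_map -{1}(subn0 N) -/(index_iota 0 N) big_mkord mulr_sumr.
  by apply: eq_bigr => i _; rewrite exprS mulrA.
rewrite [(N%:R * h) ^+ _]exprSr [leRHS]mulrA.
apply: (riemann_sum (f := J)) => //; first exact: continuous_iter_integral.
move=> i iN x xi; rewrite -(subrK (J (p i)) (J x)) -addrA.
apply: le_trans (ler_normD _ _) _; set X := _ ^+ n.
rewrite (_ : n.+1%:R * e * X = e * X + n%:R * e * X); last by rewrite -natr1; ring.
apply: lerD; last first.
  by apply: IH; [exact: seq_unif_continuous_cons|apply: seq_modulus_cons].
have := @iter_integral_cons_close a _ n F d e x (p i) ab d0 cF Fd.
rewrite [a + N%:R * h - a]addrAC subrr add0r; apply; apply: le_trans hd.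
have := pP i iN; move: xi; rewrite -(natr1 i) mulrDl mul1r addrA.
by move=> /andP[? ?] /andP[? ?]; rewrite ler_norml; apply/andP; split; lra.
Qed.

Lemma iter_sum_bound n F (v : seq R) B :
  (forall xs, size xs = n -> `|F xs| <= B) ->
  `|iter_sum v n F| <= (size v)%:R ^+ n * B.
Proof.
elim: n F => [|n IH] F FB /=; first by rewrite expr0 mul1r; exact: FB.
apply: le_trans (ler_norm_sum _ _ _) _.
apply: (@le_trans _ _ (\sum_(y <- v) ((size v)%:R ^+ n * B))).
  by apply: ler_sum => y _; apply: IH => xs xsn; apply: FB; rewrite /= xsn.
by rewrite big_const_seq count_predT iter_addr_0 exprS -mulrA mulr_natl.
Qed.

Lemma iter_integral_bound a b n F B : a <= b -> seq_unif_continuous n F ->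
  (forall xs, size xs = n -> `|F xs| <= B) ->
  `|iter_integral `[a, b] n F| <= B * (b - a) ^+ n.
Proof.
move=> ab cF FB.
have := @iter_integral_close a b n F (fun=> 0) B ab cF.
rewrite [iter_integral _ _ (fun=> 0)]iter_integral0// subr0; apply.
  by move=> e e0; exists 1; split=> // xs ys _ _ _; rewrite subrr normr0 ltW.
by move=> xs xsn; rewrite subr0; exact: FB.
Qed.

(** Boundedness is carried along because uniform continuity alone is not stable under products,
    hence not under determinants. *)
Definition seq_bounded_uc n F :=
  (exists B, forall xs, size xs = n -> `|F xs| <= B) /\ seq_unif_continuous n F.

Lemma seq_bounded_uc_cst n c : seq_bounded_uc n (fun=> c).
Proof.
split; first by exists `|c|.
by move=> e e0; exists 1; split=> // xs ys _ _ _; rewrite subrr normr0 ltW.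
Qed.

Lemma seq_bounded_ucD n F G :
  seq_bounded_uc n F -> seq_bounded_uc n G -> seq_bounded_uc n (fun xs => F xs + G xs).
Proof.
move=> [[B FB] cF] [[C GC] cG]; split.
  exists (B + C) => xs xsn; apply: le_trans (ler_normD _ _) _.
  by rewrite lerD ?FB ?GC.
move=> e e0; have e20 : 0 < e / 2 by rewrite divr_gt0.
have [d [d0 Hd]] := cF _ e20; have [d' [d'0 Hd']] := cG _ e20.
exists (Num.min d d'); split; first by rewrite lt_min d0.
move=> xs ys xsn ysn xys; rewrite opprD addrACA (le_trans (ler_normD _ _))//.
rewrite [leRHS]splitr lerD//.
  by apply: Hd => // i /xys; rewrite le_min => /andP[].
by apply: Hd' => // i /xys; rewrite le_min => /andP[].
Qed.

Lemma seq_bounded_ucM n F G :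
  seq_bounded_uc n F -> seq_bounded_uc n G -> seq_bounded_uc n (fun xs => F xs * G xs).
Proof.
move=> [[B0 FB0] cF] [[C0 GC0] cG].
pose B := `|B0| + 1; pose C := `|C0| + 1.
have B1 : 0 < B by rewrite ltr_wpDl.
have C1 : 0 < C by rewrite ltr_wpDl.
have FB xs : size xs = n -> `|F xs| <= B.
  by move=> /FB0 H; rewrite (le_trans H)// (le_trans (ler_norm _))// lerDl.
have GC xs : size xs = n -> `|G xs| <= C.
  by move=> /GC0 H; rewrite (le_trans H)// (le_trans (ler_norm _))// lerDl.
split.
  by exists (B * C) => xs xsn; rewrite normrM ler_pM ?FB ?GC.
move=> e e0.
have [|d [d0 Hd]] := cF (e / 2 / C); first by rewrite !divr_gt0.
have [|d' [d'0 Hd']] := cG (e / 2 / B); first by rewrite !divr_gt0.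
exists (Num.min d d'); split; first by rewrite lt_min d0.
move=> xs ys xsn ysn xys.
rewrite (_ : _ - _ = (F xs - F ys) * G xs + F ys * (G xs - G ys)); last by ring.
rewrite (le_trans (ler_normD _ _))// [leRHS]splitr !normrM lerD//.
  rewrite -[leRHS](divfK (lt0r_neq0 C1)) ler_pM ?GC//.
  by apply: Hd => // i /xys; rewrite le_min => /andP[].
rewrite mulrC -[leRHS](divfK (lt0r_neq0 B1)) ler_pM ?FB//.
by apply: Hd' => // i /xys; rewrite le_min => /andP[].
Qed.

Lemma seq_bounded_uc_sum n (I : Type) (r : seq I) (P : pred I) (F : I -> seq R -> R) :
  (forall i, seq_bounded_uc n (F i)) ->
  seq_bounded_uc n (fun xs => \sum_(i <- r | P i) F i xs).
Proof.
move=> H; elim: r => [|i r IH].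
  by under eq_fun do rewrite big_nil; exact: seq_bounded_uc_cst.
under eq_fun do rewrite big_cons.
by case: (P i) => //; exact: seq_bounded_ucD.
Qed.

Lemma seq_bounded_uc_prod n (I : Type) (r : seq I) (P : pred I) (F : I -> seq R -> R) :
  (forall i, seq_bounded_uc n (F i)) ->
  seq_bounded_uc n (fun xs => \prod_(i <- r | P i) F i xs).
Proof.
move=> H; elim: r => [|i r IH].
  by under eq_fun do rewrite big_nil; exact: seq_bounded_uc_cst.
under eq_fun do rewrite big_cons.
by case: (P i) => //; exact: seq_bounded_ucM.
Qed.

Lemma seq_bounded_uc_det n (E : 'I_n -> 'I_n -> seq R -> R) :
  (forall i j, seq_bounded_uc n (E i j)) ->
  seq_bounded_uc n (fun xs => \det (\matrix_(i < n, j < n) E i j xs)).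
Proof.
move=> H; rewrite /determinant; apply: seq_bounded_uc_sum => s.
apply: seq_bounded_ucM; first exact: seq_bounded_uc_cst.
by apply: seq_bounded_uc_prod => i; under eq_fun do rewrite mxE.
Qed.

Definition unif_continuous_bounded (k : R -> R) (M : R) :=
  (forall x, `|k x| <= M) /\
  forall e : R, 0 < e -> exists d : R, 0 < d /\
    forall x y, `|x - y| <= d -> `|k x - k y| <= e.

Lemma seq_bounded_uc_hankel n k M : unif_continuous_bounded k M ->
  seq_bounded_uc n (fun xs => gram_det (hankel k) n (nth 0 xs)).
Proof.
move=> [kM ck]; apply: seq_bounded_uc_det => i j; split.
  by exists M => xs _; exact: kM.
move=> e /ck[d [d0 Hd]]; exists (d / 2); split; first by rewrite divr_gt0.
move=> xs ys _ _ H; apply: Hd; rewrite opprD addrACA.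
by rewrite (le_trans (ler_normD _ _))// [leRHS]splitr lerD ?H.
Qed.

End IterIntegral.

(** * Fredholm's series as a limit of determinants *)

(** Dominated convergence for series in quantitative form: [m] is chosen before [w] and the cutoff
    [m'], so it does not depend on the grid. *)
Lemma series_dominated (R : realType) (u be : nat -> R) :
  cvgn (series be) -> (forall n, `|u n| <= be n) ->
  forall e : R, 0 < e -> exists m : nat, forall w : nat -> R,
    (forall n, `|w n| <= be n) -> forall m', (m <= m')%N ->
    `|series w m' - limn (series u)| <= \sum_(n < m) `|w n - u n| + e.
Proof.
move=> cbe ube e e0.
have be0 n : 0 <= be n by rewrite (le_trans _ (ube n)).
have nd : nondecreasing_seq (series be).
  by apply: (@nondecreasing_series _ _ xpredT 0%N) => n _ _; exact: be0.
have cu : cvgn (series u).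
  apply: normed_cvg; apply: series_le_cvg cbe => //.
  by move=> n /=; exact: normr_ge0.
have e20 : 0 < e / 2 by rewrite divr_gt0.
have /cvgrPdist_le/(_ _ e20)[m _ Hm] := cbe.
have tail w m' : (forall n, `|w n| <= be n) -> (m <= m')%N ->
    `|series w m' - series w m| <= e / 2.
  move=> wbe mm'; rewrite sub_series_geq// (le_trans (ler_norm_sum _ _ _))//.
  rewrite (le_trans (ler_sum _ (fun n _ => wbe n)))// -sub_series_geq//.
  apply: le_trans (Hm m (leqnn m)); rewrite ger0_norm ?lerD2r.
    exact: nondecreasing_cvgn_le.
  by rewrite subr_ge0; exact: nondecreasing_cvgn_le.
have ulim : `|series u m - limn (series u)| <= e / 2.
  have cu' : (fun n => `|series u m - series u n|) @ \oo --> `|series u m - limn (series u)|.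
    by apply: cvg_norm; apply: cvgB cu; exact: cvg_cst.
  rewrite -(cvg_lim _ cu')//; apply: limr_le; first by apply/cvg_ex; eexists; exact: cu'.
  exists m => // n /= mn.
  by rewrite distrC tail.
exists m => w wbe m' mm'.
rewrite (_ : _ - _ = (series w m' - series w m) + (series w m - series u m)
   + (series u m - limn (series u))); last by ring.
rewrite [e]splitr [leRHS]addrA; apply: le_trans (ler_normD _ _) _; apply: lerD => //.
apply: le_trans (ler_normD _ _) _; rewrite [leLHS]addrC; apply: lerD; last exact: tail.
by rewrite /series/= !big_mkord -sumrB; exact: ler_norm_sum.
Qed.

Section FredholmApprox.
Variable R : realType.
Notation mu := (@lebesgue_measure R).

(* From [2 |s| <= 2^-n + 2^n s^2], Hadamard's inequality and [n^n <= e^n n!]. *)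
Definition fredholm_majorant (x : R) n : R :=
  2^-1 * (2^-1 ^+ n + (2 * expR 1 * x ^+ 2) ^+ n / n`!%:R).

Lemma cvg_fredholm_majorant x : cvgn (series (fredholm_majorant x)).
Proof.
apply: is_cvg_seriesZ; apply: is_cvg_seriesD.
  rewrite exprn_geometric.
  by apply: is_cvg_geometric_series; rewrite ger0_norm// invf_lt1// ltr1n.
exact: is_cvg_series_exp_coeff.
Qed.

Lemma fredholm_majorantP (c l M t : R) n : 0 <= l -> 0 <= M ->
  t ^+ 2 <= (n%:R * M ^+ 2) ^+ n ->
  `|c ^+ n / n`!%:R * (l ^+ n * t)| <= fredholm_majorant (c * l * M) n.
Proof.
move=> l0 M0 tle.
set s := _ * (_ * t); pose q : R := 2 ^+ n.
have q0 : 0 < q by rewrite exprn_gt0.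
have fn0 : 0 < n`!%:R :> R by rewrite ltr0n fact_gt0.
(* [n ^ n / n!] is one term of the exponential series at [n]. *)
have nn : (n%:R : R) ^+ n / n`!%:R <= expR 1 ^+ n.
  rewrite -expRM_natl mulr1; case: n {tle s q q0 fn0} => [|n].
    by rewrite expr0 fact0 divr1 expR0.
  by apply: le_trans (@expR_ge1Dxn R n.+1%:R n (ler0n _ _)); rewrite lerDr.
have s2 : s ^+ 2 <= (expR 1 * (c * l * M) ^+ 2) ^+ n / n`!%:R.
  apply: (@le_trans _ _ ((c ^+ n / n`!%:R * l ^+ n) ^+ 2 * (n%:R * M ^+ 2) ^+ n)).
    by rewrite /s mulrA [leLHS]exprMn; apply: ler_wpM2l => //; exact: sqr_ge0.
  rewrite [leLHS](_ : _ = (n%:R ^+ n / n`!%:R) * (((c * l * M) ^+ 2) ^+ n / n`!%:R)); last first.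
    by rewrite !exprMn; field; rewrite gt_eqF.
  rewrite [in leRHS]exprMn -[leRHS]mulrA; apply: ler_wpM2r => //.
  by rewrite mulr_ge0 ?invr_ge0 ?(ltW fn0)// exprn_ge0// sqr_ge0.
have : 2 * `|s| <= q^-1 + q * s ^+ 2.
  rewrite -subr_ge0 (_ : _ - _ = (1 - q * `|s|) ^+ 2 / q).
    by rewrite mulr_ge0 ?sqr_ge0// invr_ge0 ltW.
  by rewrite -[in LHS](real_normK (num_real s)); field; rewrite gt_eqF.
have : q * s ^+ 2 <= (2 * expR 1 * (c * l * M) ^+ 2) ^+ n / n`!%:R.
  rewrite [leRHS](_ : _ = q * ((expR 1 * (c * l * M) ^+ 2) ^+ n / n`!%:R)).
    by apply: ler_wpM2l => //; exact: ltW.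
  rewrite [RHS]mulrA; congr (_ * _).
  by rewrite /q -exprMn [in RHS]mulrA.
rewrite /fredholm_majorant exprVn -/q => ? ?; lra.
Qed.

(** For fixed [n] the terms converge as Riemann sums, and the majorant controls the tails uniformly
    in [N]. The threshold [N0] holds for all sample points, since the two matrices of one grid are
    sampled differently. *)
Lemma fredholm_det_approx (k : R -> R) M c (a b : R) : a <= b ->
  unif_continuous_bounded k M -> forall e : R, 0 < e ->
  exists N0 : nat, forall N, (N0 <= N)%N -> forall (h : R) (p : nat -> R),
    N%:R * h = b - a ->
    (forall i, (i < N)%N -> a + i%:R * h <= p i <= a + i.+1%:R * h) ->
    `|\det (1%:M + \matrix_(i < N, j < N) (c * h * hankel k (p i) (p j))) -
      fredholm_det `[a, b] (hankel k) c| <= e.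
Proof.
move=> ab kM e e0.
pose F n (xs : seq R) := gram_det (hankel k) n (nth 0 xs).
have ucF n : seq_unif_continuous n (F n) by have [] := seq_bounded_uc_hankel n kM.
have M0 : 0 <= M by have [H _] := kM; rewrite (le_trans _ (H 0)).
have FB n xs : `|F n xs| <= Num.sqrt ((n%:R * M ^+ 2) ^+ n).
  rewrite -sqrtr_sqr; apply: ler_wsqrtr; apply: gram_det_bound => x y.
  by have [+ _] := kM; exact.
have sq n : Num.sqrt ((n%:R * M ^+ 2) ^+ n) ^+ 2 = (n%:R * M ^+ 2) ^+ n.
  by rewrite sqr_sqrtr// exprn_ge0// mulr_ge0// sqr_ge0.
pose be := fredholm_majorant (c * (b - a) * M).
have dom n (t : R) : `|t| <= (b - a) ^+ n * Num.sqrt ((n%:R * M ^+ 2) ^+ n) ->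
    `|c ^+ n / n`!%:R * t| <= be n.
  move=> H; have ba : 0 <= b - a by rewrite subr_ge0.
  apply: le_trans (fredholm_majorantP c ba M0 (t := Num.sqrt ((n%:R * M ^+ 2) ^+ n)) _).
    by rewrite !normrM ler_wpM2l// (le_trans H)// -normrM ler_norm.
  by rewrite sq.
pose u n := c ^+ n / n`!%:R * iter_integral `[a, b] n (F n).
have ube n : `|u n| <= be n.
  apply: dom; rewrite mulrC; apply: iter_integral_bound => // xs _; exact: FB.
have e20 : 0 < e / 2 by rewrite divr_gt0.
have [m Hm] := series_dominated (@cvg_fredholm_majorant (c * (b - a) * M)) ube e20.
have riem n : exists N0 : nat, forall N, (N0 <= N)%N -> forall (h : R) (p : nat -> R),
    N%:R * h = b - a ->
    (forall i, (i < N)%N -> a + i%:R * h <= p i <= a + i.+1%:R * h) ->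
    `|c ^+ n / n`!%:R * (h ^+ n * iter_sum (grid p N) n (F n)) - u n| <= e / 2 / (m%:R + 1).
  pose e' := e / 2 / (m%:R + 1) / (`|c ^+ n / n`!%:R| * (n%:R * (b - a) ^+ n) + 1).
  have den0 : 0 < `|c ^+ n / n`!%:R| * (n%:R * (b - a) ^+ n) + 1.
    by rewrite ltr_wpDl// !mulr_ge0// exprn_ge0// subr_ge0.
  have m0 : 0 < m%:R + 1 :> R by rewrite ltr_wpDl.
  have e'0 : 0 < e' by rewrite !divr_gt0.
  have [d [d0 Hd]] := ucF n _ e'0.
  exists (Num.trunc ((b - a) / d)).+1 => N N0 h p Nh pP.
  have Np : 0 < N%:R :> R by rewrite ltr0n (leq_trans _ N0).
  have h0 : 0 <= h by rewrite -(pmulr_rge0 _ Np) Nh subr_ge0.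
  have hd : h <= d.
    rewrite -(ler_pM2l Np) Nh mulrC -ler_pdivrMl// mulrC ltW//.
    by rewrite (lt_le_trans (truncnS_gt _))// ler_nat.
  have := iter_sum_riemann h0 hd (ucF n) Hd pP.
  rewrite Nh [a + (b - a)]addrC subrK => H.
  rewrite /u -mulrBr normrM distrC (le_trans (ler_wpM2l (normr_ge0 _) H))//.
  rewrite [leLHS](_ : _ = `|c ^+ n / n`!%:R| * (n%:R * (b - a) ^+ n) * e'); last by ring.
  rewrite /e' mulrC -[leLHS]mulrA -[leRHS]mulr1 ler_wpM2l//.
    by rewrite !mulr_ge0// ?invr_ge0 ltW.
  by rewrite mulrC ler_pdivrMr// mul1r lerDl.
have [N1 HN1] : exists N1 : nat, forall n, (n < m)%N -> forall N, (N1 <= N)%N ->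
    forall (h : R) (p : nat -> R), N%:R * h = b - a ->
    (forall i, (i < N)%N -> a + i%:R * h <= p i <= a + i.+1%:R * h) ->
    `|c ^+ n / n`!%:R * (h ^+ n * iter_sum (grid p N) n (F n)) - u n| <= e / 2 / (m%:R + 1).
  move: {1}m; elim=> [|m' [N1 IH]]; first by exists 0%N.
  have [N2 H2] := riem m'; exists (maxn N1 N2) => n; rewrite ltnS leq_eqVlt.
  move=> /orP[/eqP ->|nm'] N; rewrite geq_max => /andP[N1N N2N].
    exact: H2.
  exact: IH.
exists (maxn N1 1) => N; rewrite geq_max => /andP[N1N N0] h p Nh pP.
have Np : 0 < N%:R :> R by rewrite ltr0n.
have h0 : 0 <= h by rewrite -(pmulr_rge0 _ Np) Nh subr_ge0.
pose w n := c ^+ n / n`!%:R * (h ^+ n * iter_sum (grid p N) n (F n)).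
have wbe n : `|w n| <= be n.
  apply: dom; rewrite normrM ger0_norm ?exprn_ge0// -Nh exprMn [N%:R ^+ n * _]mulrC.
  rewrite -mulrA; apply: ler_wpM2l; first exact: exprn_ge0.
  by have := @iter_sum_bound R n (F n) (grid p N) _ (fun xs _ => FB n xs); rewrite size_grid.
(* The expansion is already complete at [N.+1]; the cutoff is raised to at least [m] so that the
   tail estimate applies. *)
have -> : \det (1%:M + \matrix_(i < N, j < N) (c * h * hankel k (p i) (p j))) =
    series w (maxn m N.+1).
  have := @det_add1_minor_sum R R 0 (fun x y => c * h * hankel k x y) (grid p N)
    (maxn m N.+1); rewrite size_grid => /(_ (leq_maxr _ _)) H.
  transitivity (\det (1%:M + \matrix_(i < N, j < N) (c * h * hankel k
    (nth 0 (grid p N) i) (nth 0 (grid p N) j)))).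
    by congr (\det (_ + _)); apply/matrixP => i j; rewrite !mxE !nth_grid.
  rewrite H /series/= big_mkord; apply: eq_bigr => n _.
  rewrite /w (@eq_iter_sum _ _ _ _ _ (fun xs => (c * h) ^+ n * F n xs)); last first.
    move=> xs _; rewrite /F /gram_det -detZ; congr (\det _).
    by apply/matrixP => i j; rewrite !mxE.
  rewrite iter_sumZ exprMn; ring.
have := Hm w wbe _ (leq_maxl m N.+1) => /le_trans; apply.
rewrite [leRHS]splitr lerD2r.
apply: (@le_trans _ _ (\sum_(n < m) (e / 2 / (m%:R + 1)))).
  by apply: ler_sum => n _; apply: HN1.
have m0 : 0 < m%:R + 1 :> R by rewrite ltr_wpDl.
rewrite sumr_const card_ord -[_ *+ m]mulr_natl mulrA ler_pdivrMr// mulrC ler_wpM2l//.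
  exact: ltW.
by rewrite lerDl.
Qed.

(** If some [x_i < a], then [x_i + x_j < a + t <= 0] for all [j], and row [i] of the integrand
    vanishes. *)
Lemma fredholm_det_restrict (K k : R -> R) M c a t : a <= t -> a + t <= 0 ->
  (forall x, x < 0 -> K x = 0) ->
  unif_continuous_bounded k M ->
  (forall x, 2 * a <= x <= 2 * t -> K x = k x) ->
  fredholm_det `]-oo, t[ (hankel K) c = fredholm_det `[a, t] (hankel k) c.
Proof.
move=> at_ at0 K0 kM Kk; rewrite /fredholm_det; congr (limn (series _)).
apply/funext => n; congr (_ * _).
rewrite -iter_integral_co_cc//; last first.
  by have [] := seq_bounded_uc_hankel n kM.
rewrite (@iter_integral_restrict _ _ `[a, t[%classic); first last.
- move=> xs xsn Dxs i iN nD.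
  have xia : nth 0 xs i < a.
    rewrite ltNge; apply/negP => axi; apply: nD.
    by have := Dxs i iN; rewrite /= !in_itv/= axi.
  rewrite (expand_det_row _ (Ordinal iN)) big1// => j _.
  rewrite mxE /hankel K0 ?mul0r//.
  have := Dxs j (ltn_ord j); rewrite /= in_itv/= => xjt.
  by apply: lt_le_trans at0; exact: ltrD.
- by move=> x /=; rewrite !in_itv/= => /andP[].
apply: eq_iter_integral => xs xsn Dxs; congr (\det _); apply/matrixP => i j.
rewrite !mxE /hankel Kk//.
have := Dxs i (ltn_ord i); have := Dxs j (ltn_ord j); rewrite /= !in_itv/=.
by move=> /andP[? ?] /andP[? ?]; apply/andP; split; lra.
Qed.

End FredholmApprox.

(** * Discretization of the integral equation *)

Section Discretization.
Variable R : realType.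
Notation mu := (@lebesgue_measure R).

(** Precomposition with the projection onto [[al, be]], which is 1-Lipschitz. *)
Lemma clamp_unif_continuous (K : R -> R) (al be : R) : al <= be -> continuous K ->
  exists k M, [/\ unif_continuous_bounded k M, continuous k &
    forall x, al <= x <= be -> K x = k x].
Proof.
move=> ab cK; pose cl x := Num.max al (Num.min be x).
have clP x : al <= cl x <= be by rewrite /cl le_max lexx ge_max ab ge_min lexx.
have cl1 x y : `|cl x - cl y| <= `|x - y|.
  have lip g : (forall u v, u <= v -> 0 <= g v - g u <= v - u) ->
      forall u v : R, `|g u - g v| <= `|u - v|.
    move=> H u v; wlog uv : u v / u <= v.
      move=> W; case: (leP u v) => [/W//|/ltW /W].
      by rewrite distrC [leRHS]distrC.
    have /andP[? ?] := H _ _ uv.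
    by rewrite distrC [leRHS]distrC !ger0_norm ?subr_ge0 // -subr_ge0.
  apply: (@le_trans _ _ `|Num.min be x - Num.min be y|).
    apply: (lip (fun z => Num.max al z)) => u v uv.
    by case: (lerP al u) => ?; case: (lerP al v) => ?; apply/andP; split; lra.
  apply: (lip (fun z => Num.min be z)) => u v uv.
  by case: (lerP be u) => ?; case: (lerP be v) => ?; apply/andP; split; lra.
have [M [M0 HM]] := continuous_bounded al be cK.
have uck (e : R) : 0 < e -> exists d : R, 0 < d /\
    forall x y, `|x - y| <= d -> `|K (cl x) - K (cl y)| <= e.
  move=> /(heine_cantor al be cK)[d [d0 Hd]].
  exists (d / 2); split; first by rewrite divr_gt0.
  move=> x y xy; apply: Hd => //; apply: le_lt_trans (cl1 _ _) _.
  by apply: le_lt_trans xy _; rewrite ltr_pdivrMr// ltr_pMr// ltr1n.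
exists (K \o cl), M; split.
- by split=> [x|e /uck//]; exact: HM.
- apply/continuousP_eps => x e /uck[d [d0 Hd]]; exists d; split=> // y /ltW; exact: Hd.
- by move=> x /andP[ax xb]; rewrite /= /cl (min_idPr xb) (max_idPr ax).
Qed.

(** For [x <= - a] and [K] vanishing on the negative half-line, this is the integral over the whole
    half-line below [t], as [K (x + y) = 0] for [y < a]. *)
Definition hankel_op (K : R -> R) (a t : R) (f : R -> R) (x : R) : R :=
  \int[mu]_(y in `[a, t]) (K (x + y) * f y).

Lemma continuous_hankel_integrand (K f : R -> R) x : continuous K -> continuous f ->
  continuous (fun y => K (x + y) * f y).
Proof.
move=> cK cf y; apply: cvgM; last exact: cf.
apply: (@continuous_comp _ _ _ (fun y => x + y) K); last exact: cK.
by apply: cvgD; [exact: cvg_cst|exact: cvg_id].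
Qed.

Lemma hankel_op_riemann (K k f : R -> R) M a t : a < t ->
  unif_continuous_bounded k M -> continuous k -> continuous f ->
  (forall x, 2 * a <= x <= 2 * t -> K x = k x) ->
  forall e : R, 0 < e -> exists N0 : nat, forall N, (N0 <= N)%N ->
  forall (h : R) (p : nat -> R), N%:R * h = t - a -> 0 <= h ->
    (forall i, (i < N)%N -> a + i%:R * h <= p i <= a + i.+1%:R * h) ->
    forall x, a <= x <= t ->
    `|hankel_op K a t f x - \sum_(j < N) h * (k (x + p j) * f (p j))| <= e.
Proof.
move=> at_ [kM uck] ck cf Kk e e0.
have M0 : 0 <= M by rewrite (le_trans _ (kM 0)).
have [B [B0 HB]] := continuous_bounded a t cf.
have ta : 0 < t - a by rewrite subr_gt0.
pose e' := e / (t - a) / (B + M + 1).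
have BM : 0 < B + M + 1 by rewrite ltr_wpDl// addr_ge0.
have e'0 : 0 < e' by rewrite !divr_gt0.
have [d [d0 Hd]] := uck _ e'0; have [d' [d'0 Hd']] := heine_cantor a t cf e'0.
pose dd := Num.min d d'; have dd0 : 0 < dd by rewrite lt_min d0.
exists (Num.trunc ((t - a) / dd)).+1 => N N0 h p Nh h0 pP x xat.
have Np : 0 < N%:R :> R by rewrite ltr0n (leq_trans _ N0).
have hd : h < dd.
  rewrite -(ltr_pM2l Np) Nh mulrC -ltr_pdivrMl// mulrC.
  by rewrite (lt_le_trans (truncnS_gt _))// ler_nat.
have tE : t = a + N%:R * h by rewrite Nh addrC subrK.
have -> : hankel_op K a t f x = \int[mu]_(y in `[a, t]) (k (x + y) * f y).
  apply: eq_int => y yat; rewrite Kk//.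
  by move: xat yat => /andP[? ?] /andP[? ?]; apply/andP; split; lra.
rewrite (_ : e = e' * (B + M + 1) * (N%:R * h)); last first.
  by rewrite Nh /e' !divfK ?gt_eqF.
rewrite {1}tE; apply: (@riemann_sum _ (fun y => k (x + y) * f y) a h
  (fun i => k (x + p i) * f (p i)) (e' * (B + M + 1)) N) => //.
  exact: continuous_hankel_integrand.
move=> i iN y yi; have piP := pP i iN.
have yp : `|y - p i| < dd.
  apply: le_lt_trans hd; move: yi piP; rewrite -(natr1 i) mulrDl mul1r addrA.
  by move=> /andP[? ?] /andP[? ?]; rewrite ler_norml; apply/andP; split; lra.
move: yp; rewrite lt_min => /andP[/ltW yd yd'].
have yat : a <= y <= t.
  move: yi => /andP[ya yt]; rewrite (le_trans _ ya) ?lerDl ?mulr_ge0//=.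
  by rewrite (le_trans yt)// tE lerD2l ler_wpM2r// ler_nat.
have pat : a <= p i <= t.
  move: piP => /andP[ya yt]; rewrite (le_trans _ ya) ?lerDl ?mulr_ge0//=.
  by rewrite (le_trans yt)// tE lerD2l ler_wpM2r// ler_nat.
rewrite (_ : _ - _ = (k (x + y) - k (x + p i)) * f y + k (x + p i) * (f y - f (p i))); last by ring.
apply: le_trans (ler_normD _ _) _; rewrite !normrM.
have H1 : `|k (x + y) - k (x + p i)| * `|f y| <= e' * B.
  by rewrite ler_pM ?HB//; apply: Hd; rewrite opprD addrACA subrr add0r.
have H2 : `|k (x + p i)| * `|f y - f (p i)| <= M * e' by rewrite ler_pM ?Hd'.
by apply: le_trans (lerD H1 H2) _; rewrite [M * _]mulrC -mulrDr ler_wpM2l ?(ltW e'0)// lerDl.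
Qed.

(* Sampling at the right end points of the cells gives [A], whose shift [B] is
   the sampling at the mid points. *)
Lemma discretization (K : R -> R) (c a t : R) : a < t -> a + t < 0 ->
  continuous K -> (forall x, x < 0 -> K x = 0) ->
  exists S : R, 0 <= S /\ forall f, continuous f -> forall e : R, 0 < e ->
  exists n (A B : 'M[R]_n.+1) (p : 'I_n.+1 -> R),
  [/\ `|\det (1%:M + A) - fredholm_det `]-oo, t[ (hankel K) c| <= e,
      `|\det (1%:M - B) - fredholm_det `]-oo, t[ (hankel K) (- c)| <= e,
      \det (set_col (1%:M + A) ord_max (const_mx 1)) = \det (1%:M - B) &
   [/\ forall i (g : 'cV_n.+1) G, 0 <= G -> (forall j, `|g j 0| <= G) ->
        `|\det (set_col (1%:M + A) i g)| <= S * G,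
      forall i, a <= p i <= t /\
        `|c * hankel_op K a t f (p i) - \sum_j A i j * f (p j)| <= e,
      p ord_max = t &
      forall x, a <= x <= t -> exists i, `|f x - f (p i)| <= e]].
Proof.
move=> at_ at0 cK K0.
have a2t : 2 * a <= 2 * t by rewrite ler_pM2l// ltW.
have [k [M [kM ck Kk]]] := clamp_unif_continuous a2t cK.
have M0 : 0 <= M by have [H _] := kM; rewrite (le_trans _ (H 0)).
pose L := t - a; have L0 : 0 < L by rewrite subr_gt0.
pose M' := `|c| * M; have M'0 : 0 <= M' by rewrite mulr_ge0.
(* The bound of [det_set_col_bound], with [M'] in place of [M] because the matrix entries carry the
   factor [c]. It is fixed before [f] and [e]. *)
pose S2 := (1 + L * M' ^+ 2) * expR (L * (1 + 2 * M' + 2 * L * M' ^+ 2)).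
have S20 : 0 <= S2.
  by rewrite mulr_ge0 ?expR_ge0// addr_ge0// mulr_ge0 ?sqr_ge0// ltW.
exists (Num.sqrt S2); split; first exact: sqrtr_ge0.
move=> f cf e e0; pose e' := e / (`|c| + 1).
have c10 : 0 < `|c| + 1 by rewrite ltr_wpDl.
have e'0 : 0 < e' by rewrite divr_gt0.
have [N1 HN1] := fredholm_det_approx c (ltW at_) kM e0.
have [N2 HN2] := fredholm_det_approx (- c) (ltW at_) kM e0.
have [N3 HN3] := hankel_op_riemann at_ kM ck cf Kk e'0.
have [d [d0 Hd]] := heine_cantor a t cf e0.
pose N4 := (Num.trunc (L / d)).+1.
pose n := maxn (maxn N1 N2) (maxn N3 N4); pose N := n.+1.
have N1N : (N1 <= N)%N by rewrite leqW// !leq_max leqnn ?orbT.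
have N2N : (N2 <= N)%N by rewrite leqW// !leq_max leqnn ?orbT.
have N3N : (N3 <= N)%N by rewrite leqW// !leq_max leqnn ?orbT.
have N4N : (N4 <= N)%N by rewrite leqW// !leq_max leqnn ?orbT.
have Np : 0 < N%:R :> R by rewrite ltr0n.
pose h := L / N%:R; have h0 : 0 < h by rewrite divr_gt0.
have Nh : N%:R * h = t - a by rewrite /h mulrC divfK ?gt_eqF.
have tE : t = a + N%:R * h by rewrite Nh addrC subrK.
have hd : h < d.
  rewrite -(ltr_pM2l Np) Nh mulrC -ltr_pdivrMl// mulrC.
  by rewrite (lt_le_trans (truncnS_gt _))// ler_nat.
pose p (i : nat) := a + i.+1%:R * h.
pose q (i : nat) := a + (i%:R + 2^-1) * h.
have pP i : (i < N)%N -> a + i%:R * h <= p i <= a + i.+1%:R * h.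
  by move=> _; rewrite /p lexx andbT lerD2l ler_wpM2r ?ler_nat// ltW.
have qP i : (i < N)%N -> a + i%:R * h <= q i <= a + i.+1%:R * h.
  move=> _; rewrite /q !lerD2l !ler_pM2r// -(natr1 i) lerDl lerD2l.
  by rewrite invr_ge0 ler0n invf_le1// ler1n.
have pat (i : nat) : (i < N)%N -> a <= p i <= t.
  move=> iN; rewrite /p lerDl mulr_ge0 ?(ltW h0)//=.
  by rewrite tE lerD2l ler_wpM2r ?ler_nat// ltW.
(* [p i + p j = 2 * a + (i + j + 2) * h] and [q i + q j = 2 * a + (i + j + 1) * h]: both samplings
   read the sequence [al], one index apart. *)
pose al m := c * h * k (2 * a + m.+1%:R * h).
(* For these [m] the argument of the kernel is at most [2 * a + N * h = a + t], which is
   negative. *)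
have al0 m : (m <= n)%N -> al m = 0.
  move=> mn; have H : 2 * a + m.+1%:R * h <= a + t.
    by rewrite tE addrA -mulr2n mulr_natl lerD2l ler_wpM2r ?ler_nat ?(ltW h0).
  rewrite /al -Kk ?K0 ?mulr0//; first exact: le_lt_trans at0.
  apply/andP; split; first by rewrite lerDl mulr_ge0// ltW.
  apply: le_trans H _; rewrite mulrDl !mul1r lerD2r; exact: ltW.
pose A := \matrix_(i < n.+1, j < n.+1) (c * h * hankel k (p i) (p j)).
pose B := \matrix_(i < n.+1, j < n.+1) al (i + j)%N.
have AE : A = \matrix_(i < n.+1, j < n.+1) al (i + j).+1.
  apply/matrixP => i j; rewrite !mxE /al /hankel /p; congr (_ * k _).
  by rewrite -!natr1 natrD; ring.
have BE : 1%:M - B = 1%:M + \matrix_(i < N, j < N) (- c * h * hankel k (q i) (q j)).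
  congr (_ + _); apply/matrixP => i j; rewrite !mxE /al /hankel /q -!mulNr.
  by congr (_ * k _); rewrite -!natr1 natrD; field.
exists n, A, B, (fun i : 'I_n.+1 => p i); split.
- rewrite (fredholm_det_restrict c (ltW at_) (ltW at0) K0 kM Kk).
  exact: HN1.
- rewrite BE (fredholm_det_restrict (- c) (ltW at_) (ltW at0) K0 kM Kk).
  exact: HN2.
- by rewrite AE; exact: det_hankel_set_col.
split.
- move=> i g G G0 gG; have [G00|Gn0] := eqVneq G 0.
    have -> : g = 0 *: g.
      apply/matrixP => j l; rewrite [in RHS]mxE mul0r; apply/eqP.
      by rewrite -normr_eq0 (ord1 l) eq_le normr_ge0 andbT -G00 gG.
    by rewrite det_set_colZ mul0r normr0 mulr_ge0// sqrtr_ge0.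
  have Gp : 0 < G by rewrite lt_neqAle eq_sym Gn0.
  have -> : g = G *: (G^-1 *: g) by rewrite scalerA mulfV// scale1r.
  rewrite det_set_colZ normrM ger0_norm// mulrC ler_pM2r//.
  rewrite -sqrtr_sqr; apply: ler_wsqrtr.
  apply: (@det_set_col_bound _ M' L h) => //.
    move=> i' j'; rewrite mxE 2!normrM (gtr0_norm h0) /M' [leRHS]mulrCA [leRHS]mulrA.
    by apply: ler_wpM2l; [rewrite mulr_ge0 ?(ltW h0)|have [H _] := kM; exact: H].
  by move=> j; rewrite mxE normrM normfV (ger0_norm G0) mulrC ler_pdivrMr// mul1r.
- move=> i; split; first exact: pat.
  have := HN3 N N3N h p Nh (ltW h0) pP (p i) (pat i (ltn_ord i)).
  have -> : \sum_j A i j * f (p j) = c * \sum_(j < N) h * (k (p i + p j) * f (p j)).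
    by rewrite mulr_sumr; apply: eq_bigr => j _; rewrite mxE /hankel !mulrA.
  rewrite -mulrBr normrM => H; apply: le_trans (ler_wpM2l (normr_ge0 c) H) _.
  rewrite /e' mulrCA -[leRHS]mulr1 ler_wpM2l ?(ltW e0)//.
  by rewrite ler_pdivrMr// mul1r lerDl.
- by rewrite /p tE.
move=> x /andP[ax xt].
have xh : 0 <= (x - a) / h by rewrite divr_ge0 ?subr_ge0// ltW.
(* At [x = t] truncation would give the index [N], one past the last cell. *)
have [xt'|xt'] := eqVneq x t.
  by exists ord_max; rewrite /p xt' {1}tE subrr normr0 ltW.
have iN : (Num.trunc ((x - a) / h) < n.+1)%N.
  rewrite truncn_lt_nat// ltr_pdivrMr// Nh ltrD2r.
  by rewrite lt_neqAle xt'.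
exists (Ordinal iN) => /=; apply: Hd; first by rewrite ax.
apply: le_lt_trans hd; have /andP[H1 H2] := truncn_itv xh.
move: H1 H2; rewrite ler_pdivlMr// ltr_pdivrMr// /p; move: (Num.trunc _) => T.
rewrite -(natr1 T) mulrDl mul1r; clear; move=> ? ?; by rewrite ler_norml; apply/andP; split; lra.
Qed.

Lemma le_of_eps (x y B : R) : 0 <= B ->
  (forall e : R, 0 < e -> e <= 1 -> x <= y + e * B) -> x <= y.
Proof.
move=> B0 H; apply/ler_addgt0Pr => e e0.
pose d := Num.min 1 (e / (B + 1)).
have B10 : 0 < B + 1 by rewrite ltr_wpDl.
apply: le_trans (H d _ _) _; first by rewrite lt_min ltr01 divr_gt0.
  by rewrite ge_min lexx.
rewrite lerD2l; apply: (@le_trans _ _ (e / (B + 1) * B)).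
  by apply: ler_wpM2r => //; rewrite ge_min lexx orbT.
by rewrite mulrAC ler_pdivrMr// ler_wpM2l ?(ltW e0)// lerDl.
Qed.

(** On the grid, Cramer's rule gives [|det (1 + A)| * |f (p i)| <= S * (G + e)], where [e] accounts
    for the quadrature error. Letting [e] tend to 0 yields [C = S / |D|], which does not depend on
    [f]. *)
Lemma hankel_op_apriori (K : R -> R) (c a t : R) : a < t -> a + t < 0 ->
  continuous K -> (forall x, x < 0 -> K x = 0) ->
  fredholm_det `]-oo, t[ (hankel K) c <> 0 ->
  exists C : R, 0 <= C /\ forall f, continuous f -> forall G, 0 <= G ->
  (forall x, a <= x <= t -> `|f x + c * hankel_op K a t f x| <= G) ->
  forall x, a <= x <= t -> `|f x| <= C * G.
Proof.
move=> at_ at0 cK K0; set D := fredholm_det _ _ _ => /eqP Dn0.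
have [S [S0 HS]] := discretization c at_ at0 cK K0.
have D0 : 0 < `|D| by rewrite normr_gt0.
exists (S / `|D|); split; first by rewrite divr_ge0// ltW.
move=> f cf G G0 fG x xat; have [B0 [B00 HB]] := continuous_bounded a t cf.
rewrite mulrAC ler_pdivlMr// mulrC.
apply: (@le_of_eps _ _ (B0 + (`|D| + 1) + S)).
  by rewrite !addr_ge0// ltW.
move=> e e0 e1; have [n [A [B [p [HA _ _ [Hg HK _ Hx]]]]]] := HS f cf e e0.
have [i fi] := Hx x xat; rewrite -/D in HA; set dA := \det _ in HA.
have H1 : `|dA * f (p i)| <= S * (G + e).
  have := cramer (1%:M + A) i (\col_j f (p j)); rewrite mxE -/dA => <-.
  apply: Hg; first by rewrite addr_ge0// ltW.
  move=> j; rewrite mulmxDl mul1mx mxE [X in X + _]mxE [X in _ + X]mxE.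
  under eq_bigr do rewrite mxE.
  have [pj Hj] := HK j.
  rewrite (_ : _ + _ = (f (p j) + c * hankel_op K a t f (p j)) -
    (c * hankel_op K a t f (p j) - \sum_l A j l * f (p l))); last by ring.
  apply: le_trans (ler_normB _ _) _; apply: lerD => //; exact: fG.
have dAD : `|dA| <= `|D| + 1.
  rewrite -(subrK D dA) addrC; apply: le_trans (ler_normD _ _) _.
  by rewrite lerD2l (le_trans HA).
rewrite -normrM (_ : D * f x = (D - dA) * f x + dA * (f x - f (p i)) + dA * f (p i)); last by ring.
have h1 : `|(D - dA) * f x| <= e * B0 by rewrite normrM ler_pM ?HB// distrC.
have h2 : `|dA * (f x - f (p i))| <= (`|D| + 1) * e by rewrite normrM ler_pM.
apply: le_trans (ler_normD _ _) _.
rewrite (_ : S * G + _ = (e * B0 + (`|D| + 1) * e) + S * (G + e)); last by ring.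
apply: lerD => //; apply: le_trans (ler_normD _ _) _; exact: lerD.
Qed.

Lemma fredholm_det_ratio (K : R -> R) (c a t : R) (f : R -> R) : a < t -> a + t < 0 ->
  continuous K -> (forall x, x < 0 -> K x = 0) -> continuous f ->
  (forall x, a <= x <= t -> f x + c * hankel_op K a t f x = 1) ->
  fredholm_det `]-oo, t[ (hankel K) c * f t = fredholm_det `]-oo, t[ (hankel K) (- c).
Proof.
move=> at_ at0 cK K0 cf f1; set D := fredholm_det _ _ c; set D' := fredholm_det _ _ (- c).
have [S [S0 HS]] := discretization c at_ at0 cK K0.
apply/eqP; rewrite -subr_eq0 -normr_le0.
apply: (@le_of_eps _ _ (`|f t| + S + 1)); first by rewrite !addr_ge0.
move=> e e0 e1; have [n [A [B [p [HA HB AB [Hg HK pt _]]]]]] := HS f cf e e0.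
rewrite -/D in HA; rewrite -/D' in HB; set dA := \det _ in HA.
(* The quadrature error: on the grid [(1 + A) f = 1 + eta]. In Cramer's rule at the last point,
   which is [t], the column of ones gives [det (1 - B)] and [eta] contributes at most [S * e]. *)
pose eta := \col_j (\sum_l A j l * f (p l) - c * hankel_op K a t f (p j)).
have H1 : dA * f t = \det (1%:M - B) + \det (set_col (1%:M + A) ord_max eta).
  have := cramer (1%:M + A) ord_max (\col_j f (p j)); rewrite mxE pt -/dA => <-.
  rewrite -AB -det_set_colD; congr (\det (set_col _ _ _)).
  apply/colP => j; rewrite mulmxDl mul1mx !mxE.
  under eq_bigr do rewrite mxE.
  by have [pj _] := HK j; rewrite -(f1 _ pj); ring.
have H2 : `|\det (set_col (1%:M + A) ord_max eta)| <= S * e.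
  apply: Hg => [|j]; first exact: ltW.
  by rewrite mxE distrC; have [] := HK j.
rewrite add0r (_ : D * f t - D' = (D - dA) * f t + (dA * f t - D')); last by ring.
rewrite H1 addrAC addrA; apply: le_trans (ler_normD _ _) _.
rewrite (_ : e * _ = (e * `|f t| + e) + S * e); last by ring.
apply: lerD => //; apply: le_trans (ler_normD _ _) _; apply: lerD => //.
by rewrite normrM ler_wpM2r// distrC.
Qed.

End Discretization.

(** * Derivatives of the solutions *)

Section Calculus.
Variable R : realType.
Notation mu := (@lebesgue_measure R).
Implicit Types (f g K : R -> R) (a b c x y t s : R).

(** The derivative as a first-order expansion, without a quotient, so that estimates of integrals
    apply to it directly. *)
Definition has_slope f x l := forall e : R, 0 < e -> exists d : R, 0 < d /\
  forall y, `|y - x| < d -> `|f y - f x - (y - x) * l| <= e * `|y - x|.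

Lemma has_slope_is_derive f x l : has_slope f x l -> is_derive x (1 : R) f l.
Proof.
move=> H; suff cf : (fun h : R => h^-1 *: (f (h *: (1 : R) + x) - f x)) @ 0^' --> l.
  by apply: DeriveDef; [apply/cvg_ex; exists l; exact: cf|exact: cvg_lim cf].
apply/cvgrPdist_le => e e0; have [d [d0 Hd]] := H e e0.
apply/nbhs_ballP; exists d => //= h /=; rewrite -ball_normE /= sub0r normrN => hd hn0.
have := Hd (h + x); rewrite addrK => /(_ hd).
rewrite [h *: 1]mulr1 -(ler_pM2l (_ : 0 < `|h^-1|)); last by rewrite normr_gt0 invr_eq0.
rewrite -normrM (_ : h^-1 * _ = h^-1 *: (f (h + x) - f x) - l); last first.
  by rewrite mulrBr mulKf.
rewrite [X in _ <= X -> _]mulrCA -normrM mulVf// normr1 mulr1.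
by rewrite [in X in _ -> X]distrC.
Qed.

Lemma has_slope_continuous f : (forall x, exists l, has_slope f x l) -> continuous f.
Proof.
move=> H; apply/continuousP_eps => x e e0; have [l Hl] := H x.
have [d [d0 Hd]] := Hl 1 ltr01.
have l1 : 0 < 1 + `|l| by rewrite ltr_pwDl.
exists (Num.min d (e / (1 + `|l|))); split; first by rewrite lt_min d0 divr_gt0.
move=> y; rewrite lt_min distrC => /andP[/Hd H1 H2].
rewrite distrC (_ : f y - f x = (f y - f x - (y - x) * l) + (y - x) * l); last by ring.
rewrite mul1r in H1; apply: le_trans (ler_normD _ _) _; rewrite [in leLHS]normrM.
apply: (@le_trans _ _ (`|y - x| * (1 + `|l|))); first by rewrite mulrDr mulr1 lerD.
by rewrite -ler_pdivlMr// ltW.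
Qed.

Lemma has_slope_cst c x : has_slope (fun=> c) x 0.
Proof.
move=> e e0; exists 1; split=> // y _.
by rewrite mulr0 subr0 subrr normr0 mulr_ge0// ltW.
Qed.

Lemma has_slope_shift f c x l : has_slope f (c + x) l ->
  has_slope (fun y => f (c + y)) x l.
Proof.
move=> H e /H[d [d0 Hd]]; exists d; split=> // y yx.
by have := Hd (c + y); rewrite opprD addrACA subrr add0r; apply.
Qed.

Lemma has_slopeZ f c x l : has_slope f x l -> has_slope (fun y => c * f y) x (c * l).
Proof.
move=> H e e0; have c0 : 0 < `|c| + 1 by rewrite ltr_wpDl.
have [d [d0 Hd]] := H _ (divr_gt0 e0 c0).
exists d; split=> // y /Hd yx.
rewrite (_ : _ - _ = c * (f y - f x - (y - x) * l)); last by ring.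
rewrite normrM; apply: le_trans (ler_wpM2l (normr_ge0 _) yx) _.
rewrite mulrA ler_wpM2r// mulrCA -[leRHS]mulr1 ler_wpM2l ?(ltW e0)//.
by rewrite ler_pdivrMr// mul1r lerDl.
Qed.

Lemma has_slopeD f g x l l' : has_slope f x l -> has_slope g x l' ->
  has_slope (fun y => f y + g y) x (l + l').
Proof.
move=> Hf Hg e e0; have e20 : 0 < e / 2 by rewrite divr_gt0.
have [d [d0 Hd]] := Hf _ e20; have [d' [d'0 Hd']] := Hg _ e20.
exists (Num.min d d'); split; first by rewrite lt_min d0.
move=> y; rewrite lt_min => /andP[/Hd h1 /Hd' h2].
rewrite (_ : _ - _ = (f y - f x - (y - x) * l) + (g y - g x - (y - x) * l')); last by ring.
apply: le_trans (ler_normD _ _) _.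
by rewrite [leRHS](_ : _ = e / 2 * `|y - x| + e / 2 * `|y - x|) ?lerD// -mulrDl -splitr.
Qed.

Lemma has_slopeM f g x l l' : has_slope f x l -> has_slope g x l' ->
  has_slope (fun y => f y * g y) x (l * g x + f x * l').
Proof.
move=> Hf Hg e e0; pose Q := `|g x| + `|f x| + (1 + `|l|) * (1 + `|l'|).
have Q0 : 0 < Q by rewrite ltr_wpDl// mulr_gt0// ltr_pwDl.
have e'0 : 0 < e / Q by rewrite divr_gt0.
have [d [d0 Hd]] := Hf _ e'0; have [d' [d'0 Hd']] := Hg _ e'0.
have [d1 [d10 Hd1]] := Hf _ ltr01; have [d2 [d20 Hd2]] := Hg _ ltr01.
have lip h m y : `|h y - h x - (y - x) * m| <= 1 * `|y - x| ->
    `|h y - h x| <= `|y - x| * (1 + `|m|).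
  move=> H; rewrite (_ : h y - h x = (h y - h x - (y - x) * m) + (y - x) * m); last by ring.
  apply: le_trans (ler_normD _ _) _; rewrite [`|_ * m|]normrM mulrDr mulr1 lerD//.
  by rewrite -[leRHS]mul1r.
exists (Num.min (Num.min d d') (Num.min (Num.min d1 d2) (e / Q))); split.
  by rewrite !lt_min d0 d'0 d10 d20.
move=> y; rewrite !lt_min => /andP[/andP[/Hd h1 /Hd' h2] /andP[/andP[/Hd1/lip h3 /Hd2/lip h4] yQ]].
rewrite (_ : _ - _ = (f y - f x - (y - x) * l) * g x + f x * (g y - g x - (y - x) * l') +
  (f y - f x) * (g y - g x)); last by ring.
apply: (@le_trans _ _ (e / Q * `|y - x| * `|g x| + `|f x| * (e / Q * `|y - x|) +
   `|y - x| * (1 + `|l|) * (e / Q * (1 + `|l'|)))).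
  apply: le_trans (ler_normD _ _) _; apply: lerD.
    apply: le_trans (ler_normD _ _) _; rewrite !normrM.
    by apply: lerD; rewrite ?ler_wpM2r ?ler_wpM2l.
  rewrite normrM ler_pM// (le_trans h4)// ler_wpM2r ?addr_ge0//; exact: ltW.
rewrite [leLHS](_ : _ = e / Q * Q * `|y - x|); last by rewrite /Q; ring.
by rewrite divfK// gt_eqF.
Qed.

Lemma between_dist x y z : Num.min x y <= z <= Num.max x y -> `|z - x| <= `|y - x|.
Proof.
have [xy|yx] := leP x y => /andP[? ?].
  by rewrite !ger0_norm ?subr_ge0// lerD2r.
by rewrite distrC [leRHS]distrC !ger0_norm ?subr_ge0 ?(ltW yx)// lerD2l lerN2.
Qed.

Lemma int_upper_slope f a x y l e : continuous f -> a <= x -> a <= y ->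
  (forall z, Num.min x y <= z <= Num.max x y -> `|f z - l| <= e) ->
  `|\int[mu]_(z in `[a, y]) f z - \int[mu]_(z in `[a, x]) f z - (y - x) * l| <=
  e * `|y - x|.
Proof.
move=> cf ax ay; have [xy|/ltW yx] := leP x y => H.
  rewrite (int_split cf ax xy) [`|y - x|]ger0_norm ?subr_ge0//; have := int_approx cf xy H.
  set A := \int[mu]_(z in `[a, x]) f z; set B := \int[mu]_(z in `[x, y]) f z.
  by rewrite (_ : A + B - A - (y - x) * l = B - (y - x) * l); last by ring.
rewrite (int_split cf ay yx) distrC [`|y - x|]distrC [`|x - y|]ger0_norm ?subr_ge0//.
have := int_approx cf yx H.
set A := \int[mu]_(z in `[a, y]) f z; set B := \int[mu]_(z in `[y, x]) f z.
by rewrite (_ : (y - x) * l - (A - (A + B)) = B - (x - y) * l); last by ring.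
Qed.

(** The signed integral from 0 is a primitive on the whole line. The second clause keeps the error
    explicit for any [l] and [e], so that it can be made uniform in a parameter under another
    integral. *)
Lemma primitive g : continuous g -> exists G : R -> R,
  (forall x y, x <= y -> G y - G x = \int[mu]_(z in `[x, y]) g z) /\
  (forall x y l e, (forall z, `|z - x| <= `|y - x| -> `|g z - l| <= e) ->
     `|G y - G x - (y - x) * l| <= e * `|y - x|).
Proof.
move=> cg; pose G x := if 0 <= x then \int[mu]_(z in `[0, x]) g z
  else - (\int[mu]_(z in `[x, 0]) g z).
have GE x y : x <= y -> G y - G x = \int[mu]_(z in `[x, y]) g z.
  move=> xy; rewrite /G; have [x0|x0] := leP 0 x.
    by rewrite (le_trans x0 xy) (int_split cg x0 xy) addrAC subrr add0r.
  have [y0|/ltW y0] := leP 0 y.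
    by rewrite opprK addrC -int_split// ltW.
  by rewrite opprK (int_split cg xy y0) addrC addrK.
exists G; split=> // x y l e H; have [xy|/ltW yx] := leP x y.
  rewrite GE// [`|y - x|]ger0_norm ?subr_ge0//; apply: int_approx => // z /andP[xz zy].
  by apply: H; apply: between_dist; rewrite (min_idPl xy) (max_idPr xy) xz.
rewrite distrC (_ : (y - x) * l - _ = G x - G y - (x - y) * l); last by ring.
rewrite GE// [`|y - x|]distrC [`|x - y|]ger0_norm ?subr_ge0//; apply: int_approx => // z /andP[yz zx].
by apply: H; apply: between_dist; rewrite (min_idPr yx) (max_idPl yx) yz.
Qed.

Lemma slope_FTC f g a b : continuous g -> (forall x, has_slope f x (g x)) -> a <= b ->
  \int[mu]_(x in `[a, b]) g x = f b - f a.
Proof.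
move=> cg fg ab; have [G [GE Gs]] := primitive cg.
rewrite -GE//; suff : f b - G b = f a - G a by lra.
apply: (@is_derive_0_is_cst _ (fun x => f x - G x)) => x.
apply: has_slope_is_derive => e e0; have e20 : 0 < e / 2 by rewrite divr_gt0.
have [d [d0 Hd]] := fg x _ e20.
have [d' [d'0 Hd']] := (continuousP_eps g).1 cg x _ e20.
exists (Num.min d d'); split; first by rewrite lt_min d0.
move=> y; rewrite lt_min => /andP[/Hd H1 yx].
have H2 : `|G y - G x - (y - x) * g x| <= e / 2 * `|y - x|.
  by apply: Gs => z zx; rewrite distrC Hd'// distrC (le_lt_trans zx).
rewrite mulr0 subr0 [X in `|X|](_ : _ = (f y - f x - (y - x) * g x) -
  (G y - G x - (y - x) * g x)); last by ring.
apply: le_trans (ler_normB _ _) _.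
by rewrite [leRHS](_ : _ = e / 2 * `|y - x| + e / 2 * `|y - x|) ?lerD// -mulrDl -splitr.
Qed.

Lemma integrable_mul f g a b : continuous g -> mu.-integrable `[a, b] (EFin \o f) ->
  mu.-integrable `[a, b] (fun x => (g x * f x)%:E).
Proof.
move=> cg fi.
have [M [M0 HM]] := continuous_bounded a b cg.
have := @integrableMr _ _ _ mu `[a, b]%classic (measurable_itv _) g (EFin \o f) _ _ fi.
apply.
- by apply: measurable_funTS; exact: measurable_realfun.continuous_measurable_fun.
- exists M; split; first exact: num_real.
  by move=> B MB x /=; rewrite in_itv/= => /HM /le_trans; apply; exact: ltW.
Qed.

(** The operator smooths: uniform continuity of [K] on a compact interval suffices, with [f] merely
    integrable. This is the source of the continuous representatives of L2 solutions. *)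
Lemma continuous_hankel_op_integrable K f a t : continuous K ->
  mu.-integrable `[a, t] (EFin \o f) -> continuous (hankel_op K a t f).
Proof.
move=> cK fi; apply/continuousP_eps => x e e0.
have fni : mu.-integrable `[a, t] (EFin \o (fun y => `|f y|)) by apply: integrable_norm fi.
set I := \int[mu]_(y in `[a, t]) `|f y|.
have I0 : 0 <= I by apply: Rintegral_ge0 => y _; exact: normr_ge0.
have I1 : 0 < I + 1 by rewrite ltr_wpDl.
have [d [d0 Hd]] := heine_cantor (x + a) (x + t) cK (divr_gt0 e0 I1).
exists d; split=> // y xy.
have cs z : continuous (fun u => K (z + u)).
  move=> u; apply: (@continuous_comp _ _ _ (fun y => z + y) K); last exact: cK.
  by apply: cvgD; [exact: cvg_cst|exact: cvg_id].
have i1 z : mu.-integrable `[a, t] (EFin \o (fun u => K (z + u) * f u)).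
  exact: integrable_mul.
have iB : mu.-integrable `[a, t] (EFin \o (fun u => K (x + u) * f u - K (y + u) * f u)).
  by apply: integrableB (i1 x) (i1 y).
rewrite /hankel_op -RintegralB//.
apply: le_trans (le_normr_Rintegral _ _) _ => //.
apply: (@le_trans _ _ (\int[mu]_(u in `[a, t]) (e / (I + 1) * `|f u|))).
  apply: le_Rintegral => //.
  - exact: integrable_norm.
  - by apply: integrableZl fni.
  move=> u; rewrite /= in_itv/= => /andP[au ut].
  rewrite -mulrBl normrM ler_wpM2r// Hd ?lerD2l ?au ?ut//.
  by rewrite opprD addrACA subrr addr0.
rewrite RintegralZl// -/I mulrAC ler_pdivrMr// ler_wpM2l ?(ltW e0)//.
by rewrite lerDl.
Qed.

Lemma continuous_hankel_op K f a t : continuous K -> continuous f ->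
  continuous (hankel_op K a t f).
Proof.
by move=> cK cf; apply: continuous_hankel_op_integrable => //; exact: continuous_integrable.
Qed.

Lemma hankel_opD K f g a t x : continuous K -> continuous f -> continuous g ->
  hankel_op K a t (fun y => f y + g y) x = hankel_op K a t f x + hankel_op K a t g x.
Proof.
move=> cK cf cg.
rewrite /hankel_op -(intD a t (@continuous_hankel_integrand R _ _ x cK cf)
  (@continuous_hankel_integrand R _ _ x cK cg)).
by apply: eq_int => y _; rewrite mulrDr.
Qed.

Lemma hankel_opZ K f c a t x : continuous K -> continuous f ->
  hankel_op K a t (fun y => c * f y) x = c * hankel_op K a t f x.
Proof.
move=> cK cf; rewrite /hankel_op -(intZ a t c (@continuous_hankel_integrand R _ _ x cK cf)).
by apply: eq_int => y _; rewrite mulrCA.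
Qed.

End Calculus.

(** * Stability in the upper limit and the derivative with respect to it *)

Section Kernel.
Variable R : realType.
Notation mu := (@lebesgue_measure R).
Variables (K : R -> R) (T : R).
Hypotheses (cK : continuous K) (K0 : forall x, x < 0 -> K x = 0) (T0 : 0 < T).
Implicit Types (f g : R -> R) (c x y t s : R).

Local Notation Kop := (hankel_op K (- T)).

Lemma kernel_bound : exists M : R, 0 <= M /\
  forall x y, - T <= x <= T -> - T <= y <= T -> `|K (x + y)| <= M.
Proof.
have [M [M0 HM]] := continuous_bounded (- T - T) (T + T) cK.
exists M; split=> // x y /andP[? ?] /andP[? ?]; apply: HM.
by apply/andP; split; lra.
Qed.

Lemma hankel_op_bound M f B t x :
  (forall x y, - T <= x <= T -> - T <= y <= T -> `|K (x + y)| <= M) ->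
  continuous f -> - T <= t <= T -> - T <= x <= T ->
  (forall y, - T <= y <= t -> `|f y| <= B) ->
  `|Kop t f x| <= M * B * (t + T).
Proof.
move=> HM cf /andP[Tt tT] xT fB; rewrite -[X in _ * (_ + X)]opprK.
apply: int_bound => //; first exact: continuous_hankel_integrand.
move=> y /andP[ay yt]; rewrite normrM ler_pM ?fB ?ay//.
by apply: HM => //; rewrite ay (le_trans yt).
Qed.

Lemma hankel_op_lipschitz M f B t s x :
  (forall x y, - T <= x <= T -> - T <= y <= T -> `|K (x + y)| <= M) ->
  continuous f -> - T <= t <= T -> - T <= s <= T -> - T <= x <= T ->
  (forall y, - T <= y <= T -> `|f y| <= B) ->
  `|Kop s f x - Kop t f x| <= M * B * `|s - t|.
Proof.
move=> HM cf /andP[Tt tT] /andP[Ts sT] xT fB.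
have := @int_upper_slope R (fun y => K (x + y) * f y) (- T) t s 0 (M * B)
  (continuous_hankel_integrand cK cf) Tt Ts.
rewrite mulr0 subr0; apply => z; rewrite subr0 ge_min le_max => /andP[tz zt].
have zT : - T <= z <= T.
  apply/andP; split; first by case/orP: tz; exact: le_trans.
  by case/orP: zt => /le_trans; apply.
by rewrite normrM ler_pM ?fB ?HM.
Qed.

(* The a priori estimate at [t] extends from [-T, t] to [-T, T], where it is
   stable under small changes of [t]. *)
Lemma hankel_op_apriori_stable c t : 0 <= t < T ->
  fredholm_det `]-oo, t[ (hankel K) c <> 0 ->
  exists C d : R, [/\ 0 <= C, 0 < d & forall s, 0 <= s < T -> `|s - t| < d ->
    forall f, continuous f -> forall G, 0 <= G ->
    (forall x, - T <= x <= T -> `|f x + c * Kop s f x| <= G) ->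
    forall x, - T <= x <= T -> `|f x| <= C * G].
Proof.
move=> /andP[t0 tT] D0; have [M [M0 HM]] := kernel_bound.
have Tt : - T < t by lra.
have Tt0 : - T + t < 0 by lra.
have [C0 [C00 HC0]] := hankel_op_apriori Tt Tt0 cK K0 D0.
(* On [[- T, T]] write [f] as [(f + c Kop t f) - c Kop t f]; the second term involves [f] on
   [[- T, t]] only, where it is at most [C0 * G]. *)
pose C1 := 1 + C0 * (1 + `|c| * M * (T + T)).
have cM : 0 <= `|c| * M by rewrite mulr_ge0.
have C10 : 0 < C1 by rewrite ltr_pwDl// mulr_ge0// addr_ge0// mulr_ge0// addr_ge0// ltW.
have tTT : - T <= t <= T by rewrite (ltW Tt) (ltW tT).
have H1 f : continuous f -> forall G, 0 <= G ->
    (forall x, - T <= x <= T -> `|f x + c * Kop t f x| <= G) ->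
    forall x, - T <= x <= T -> `|f x| <= C1 * G.
  move=> cf G G0 fG x xT.
  have fC0 y : - T <= y <= t -> `|f y| <= C0 * G.
    apply: HC0 => // z /andP[az zt]; apply: fG; rewrite az; lra.
  have KB := hankel_op_bound HM cf tTT xT fC0.
  rewrite (_ : f x = (f x + c * Kop t f x) - c * Kop t f x); last by ring.
  apply: le_trans (ler_normB _ _) _; rewrite normrM.
  have h2 : `|c| * `|Kop t f x| <= `|c| * (M * (C0 * G) * (T + T)).
    apply: ler_wpM2l => //; apply: le_trans KB _; apply: ler_wpM2l.
      by rewrite !mulr_ge0.
    by rewrite lerD2r ltW.
  apply: le_trans (lerD (fG x xT) h2) _.
  rewrite (_ : C1 * G = G + `|c| * (M * (C0 * G) * (T + T)) + C0 * G); last by rewrite /C1; ring.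
  by rewrite lerDl mulr_ge0.
(* With this [d], passing from [t] to [s] costs at most half of the maximum [B] of [|f|], which is
   absorbed on the left and doubles the constant. *)
pose d := (2 * C1 * (`|c| * M + 1))^-1.
have cM1 : 0 < `|c| * M + 1 by rewrite ltr_wpDl.
have den0 : 0 < 2 * C1 * (`|c| * M + 1) by rewrite !mulr_gt0.
exists (2 * C1), d; split; [by rewrite mulr_ge0// ltW|by rewrite invr_gt0|].
move=> s /andP[s0 sT] sd f cf G G0 fG.
have cn : {within `[- T, T], continuous (fun x => `|f x|)}.
  apply: continuous_subspaceT => x; apply: (@continuous_comp _ _ _ f (fun y : R => `|y|)).
    exact: cf.
  exact: norm_continuous.
have TN0 : - T <= 0 by rewrite oppr_le0 ltW.
have TT : - T <= T by rewrite (le_trans TN0)// ltW.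
have [x0 x0T Hx0] := EVT_max TT cn.
rewrite in_itv/= in x0T; set B := `|f x0| in Hx0.
have fB y : - T <= y <= T -> `|f y| <= B by move=> yT; apply: Hx0; rewrite in_itv.
have B0 : 0 <= B by exact: normr_ge0.
have sTT : - T <= s <= T by rewrite (le_trans TN0)//= ltW.
have : B <= C1 * (G + `|c| * (M * B * `|s - t|)).
  apply: H1 => //; first by rewrite addr_ge0// !mulr_ge0.
  move=> x xT; have := hankel_op_lipschitz HM cf tTT sTT xT fB => H.
  rewrite (_ : _ + _ = (f x + c * Kop s f x) - c * (Kop s f x - Kop t f x)); last by ring.
  apply: le_trans (ler_normB _ _) _; apply: lerD; first exact: fG.
  by rewrite normrM ler_wpM2l.
have : C1 * (`|c| * (M * B * `|s - t|)) <= B / 2.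
  rewrite [leLHS](_ : _ = B * (C1 * (`|c| * M) * `|s - t|)); last by ring.
  apply: ler_wpM2l => //.
  apply: (@le_trans _ _ (C1 * (`|c| * M) * d)).
    by apply: ler_wpM2l; [rewrite mulr_ge0// ltW|exact: ltW].
  rewrite /d ler_pdivrMr// [leRHS](_ : _ = C1 * (`|c| * M + 1)); last by field.
  by apply: ler_wpM2l; [exact: ltW|rewrite lerDl].
rewrite mulrDr => h1 h2 x /fB /le_trans; apply.
by move: h1 h2; clear; lra.
Qed.

Lemma hankel_op_inj c t : 0 <= t < T -> fredholm_det `]-oo, t[ (hankel K) c <> 0 ->
  forall f, continuous f -> (forall x, - T <= x <= t -> f x + c * Kop t f x = 0) ->
  forall x, - T <= x <= t -> f x = 0.
Proof.
move=> /andP[t0 tT] D0 f cf f0 x xt.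
have Tt : - T < t by lra.
have Tt0 : - T + t < 0 by lra.
have [C [C0 HC]] := hankel_op_apriori Tt Tt0 cK K0 D0.
apply/eqP; rewrite -normr_le0 -(mulr0 C); apply: HC => // y yt.
by rewrite f0// normr0.
Qed.

(** Formally, differentiating the equation in [t] gives [f + c K[t] f = - c K(x + t) Phi(t, t)] for
    the derivative [f], whose solution is the multiple of [phi] stated. To justify it, the remainder
    [r] of the first-order expansion is put into the equation at [s] and bounded by the stable a
    priori estimate. *)
Lemma slope_in_upper_end c t (Phi : R -> R -> R) (phi : R -> R) : 0 < t < T ->
  fredholm_det `]-oo, t[ (hankel K) c <> 0 ->
  (forall s, 0 <= s < T -> continuous (Phi s)) ->
  (forall s, 0 <= s < T -> forall x, - T <= x <= T -> Phi s x + c * Kop s (Phi s) x = 1) ->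
  continuous phi ->
  (forall x, - T <= x <= T -> phi x + c * Kop t phi x = K (x + t)) ->
  forall x, - T <= x <= T ->
  has_slope (fun s => Phi s x) t (- c * Phi t t * phi x).
Proof.
move=> /andP[t0 tT] D0 cPhi ePhi cphi ephi x xT e e0.
have tT' : 0 <= t < T by rewrite (ltW t0).
have tTT : - T <= t <= T by apply/andP; split; lra.
have [C [d0 [C0 d00 HC]]] := hankel_op_apriori_stable tT' D0.
have [M [M0 HM]] := kernel_bound.
have [B1 [B10 HB1]] := continuous_bounded (- T) T (cPhi t tT').
have [B2 [B20 HB2]] := continuous_bounded (- T) T cphi.
set p := Phi t t.
pose Q := C * (`|c| * (B1 + M + `|c * p| * (M * B2))) + 1.
have Q0 : 0 < Q by rewrite ltr_wpDl// !mulr_ge0// !addr_ge0// !mulr_ge0.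
pose e' := e / Q; have e'0 : 0 < e' by rewrite divr_gt0.
have [d1 [d10 Hd1]] := heine_cantor (- T - T) (T + T) cK e'0.
have [d2 [d20 Hd2]] := (continuousP_eps (Phi t)).1 (cPhi t tT') t e' e'0.
pose d := Num.min (Num.min d0 e') (Num.min (Num.min d1 d2) (Num.min t (T - t))).
exists d; split.
  by rewrite !lt_min d00 e'0 d10 d20 t0 subr_gt0.
move=> s; rewrite !lt_min => /andP[/andP[sd0 se'] /andP[/andP[sd1 sd2] /andP[st sTt]]].
have sT : 0 <= s < T.
  move: st sTt; rewrite !ltr_norml => /andP[+ _] /andP[_ +].
  by rewrite ltrBrDl subrr ltrD2r => /ltW -> ->.
have sTT : - T <= s <= T.
  by move/andP: sT => [? ?]; rewrite (le_trans (_ : _ <= 0))//= ?oppr_le0 ltW.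
pose r y := Phi s y - Phi t y + (s - t) * (c * p) * phi y.
have cr : continuous r.
  move=> y; apply: cvgD; first by apply: cvgB; exact: cPhi.
  by apply: cvgM; [exact: cvg_cst|exact: cphi].
rewrite (_ : _ - _ = r x); last by rewrite /r -/p; ring.
(* Two errors remain: that of differentiating the integral of [Phi t] in its upper limit, and that
   of replacing [Kop t phi] by [Kop s phi], which already carries the factor [s - t]. *)
have re y : - T <= y <= T -> r y + c * Kop s r y =
    - c * (Kop s (Phi t) y - Kop t (Phi t) y - (s - t) * (K (y + t) * p)) +
    (s - t) * (c * p) * c * (Kop s phi y - Kop t phi y).
  move=> yT.
  have -> : Kop s r y = Kop s (Phi s) y - Kop s (Phi t) y + (s - t) * (c * p) * Kop s phi y.
    have c1 : continuous (fun y => -1 * Phi t y).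
      by move=> z; apply: cvgM; [exact: cvg_cst|exact: cPhi].
    have c2 : continuous (fun y => (s - t) * (c * p) * phi y).
      by move=> z; apply: cvgM; [exact: cvg_cst|exact: cphi].
    have c3 : continuous (fun y => Phi s y + -1 * Phi t y).
      by move=> z; apply: cvgD; [exact: cPhi|exact: c1].
    rewrite (_ : r = fun y => (Phi s y + -1 * Phi t y) + (s - t) * (c * p) * phi y); last first.
      by apply/funext => z; rewrite /r mulN1r.
    rewrite hankel_opD// hankel_opD//; [|exact: cPhi].
    by rewrite !hankel_opZ ?mulN1r//; exact: cPhi.
  have h1 := ePhi s sT y yT; have h2 := ePhi t tT' y yT; have h3 := ephi y yT.
  rewrite -h3 /r.
  rewrite (_ : Phi s y = 1 - c * Kop s (Phi s) y); last by rewrite -h1; ring.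
  rewrite (_ : Phi t y = 1 - c * Kop t (Phi t) y); last by rewrite -h2; ring.
  ring.
have rG y : - T <= y <= T -> `|r y + c * Kop s r y| <=
    `|c| * (B1 + M + `|c * p| * (M * B2)) * e' * `|s - t|.
  move=> yT; rewrite re//; apply: le_trans (ler_normD _ _) _.
  have h1 : `|Kop s (Phi t) y - Kop t (Phi t) y - (s - t) * (K (y + t) * p)| <=
      (B1 + M) * e' * `|s - t|.
    apply: (int_upper_slope (f := fun z => K (y + z) * Phi t z)).
    - exact: continuous_hankel_integrand cK (cPhi t tT').
    - by case/andP: tTT.
    - by case/andP: sTT.
    move=> z ztss; have zts := between_dist ztss.
    have zT : - T <= z <= T.
      move: ztss; rewrite ge_min le_max => /andP[tz zt].
      have [[Tt _] [Ts sT']] := (andP tTT, andP sTT); apply/andP; split.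
        by case/orP: tz; apply: le_trans.
      by case/orP: zt => /le_trans; apply => //; exact: ltW.
    rewrite (_ : _ - _ = (K (y + z) - K (y + t)) * Phi t z + K (y + t) * (Phi t z - p)); last by ring.
    rewrite [leRHS]mulrDl; apply: le_trans (ler_normD _ _) _; rewrite !normrM; apply: lerD.
      rewrite mulrC ler_pM ?HB1//; apply: Hd1.
        by have [/andP[? ?] /andP[? ?]] := (zT, yT); rewrite !lerD.
      by rewrite opprD addrACA subrr add0r (le_lt_trans zts).
    rewrite ler_pM ?HM// distrC; apply: Hd2.
    by rewrite distrC (le_lt_trans zts).
  have h2 : `|Kop s phi y - Kop t phi y| <= M * B2 * e'.
    apply: le_trans (hankel_op_lipschitz HM cphi tTT sTT yT HB2) _.
    by rewrite ler_wpM2l ?mulr_ge0// ltW.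
  rewrite (_ : `|c| * (B1 + M + `|c * p| * (M * B2)) * e' * `|s - t| =
     `|c| * ((B1 + M) * e' * `|s - t|) + `|s - t| * `|c * p| * `|c| * (M * B2 * e')); last by ring.
  apply: lerD; first by rewrite normrM normrN ler_wpM2l.
  by rewrite 3!normrM ler_wpM2l// !mulr_ge0.
have := HC s sT sd0 r cr _ _ rG x xT.
move=> /(_ _)/le_trans; apply.
  apply: mulr_ge0 => //; apply: mulr_ge0; last exact: ltW.
  by rewrite mulr_ge0// addr_ge0// ?addr_ge0// !mulr_ge0.
rewrite !mulrA ler_wpM2r// -!mulrA [X in C * X]mulrA [C * _]mulrA /e' mulrCA.
rewrite -[leRHS]mulr1 ler_wpM2l ?(ltW e0)//.
by rewrite ler_pdivrMr// mul1r /Q lerDl.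
Qed.

End Kernel.

(** * The derivative in the space variable *)

Section SpaceDerivative.
Variable R : realType.
Notation mu := (@lebesgue_measure R).
Variables (K : R -> R) (T : R).
Hypotheses (cK : continuous K) (K0 : forall x, x < 0 -> K x = 0) (T0 : 0 < T).
Implicit Types (f g : R -> R) (c x y t s : R).

Local Notation Kop := (hankel_op K (- T)).

Lemma kernel0 : K 0 = 0.
Proof.
apply/eqP; rewrite -normr_le0; apply/ler_addgt0Pr => e e0; rewrite add0r.
have [d [d0 Hd]] := (continuousP_eps K).1 cK 0 e e0.
have := Hd (- (d / 2)); rewrite opprK add0r ger0_norm ?divr_ge0 ?(ltW d0)//.
rewrite (K0 (x := - (d / 2))) ?oppr_lt0 ?divr_gt0// subr0; apply.
by rewrite ltr_pdivrMr// ltr_pMr// ltr1n.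
Qed.

Lemma primitive_kernel : exists k1 : R -> R,
  [/\ continuous k1, (forall x, has_slope k1 x (K x)), (forall x, x <= 0 -> k1 x = 0) &
   forall x y l e, (forall z, `|z - x| <= `|y - x| -> `|K z - l| <= e) ->
     `|k1 y - k1 x - (y - x) * l| <= e * `|y - x|].
Proof.
have [G [GE Gs]] := primitive cK.
have slope x : has_slope (fun x => G x - G 0) x (K x).
  move=> e e0; have [d [d0 Hd]] := (continuousP_eps K).1 cK x e e0.
  exists d; split=> // y yx; rewrite (_ : G y - G 0 - (G x - G 0) = G y - G x); last by ring.
  by apply: Gs => z zx; rewrite distrC Hd// distrC (le_lt_trans zx).
exists (fun x => G x - G 0); split=> //.
- by apply: has_slope_continuous => x; exists (K x).
- move=> x x0; rewrite -opprB GE//.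
  have : `|\int[mu]_(z in `[x, 0]) K z| <= 0 * (0 - x).
    apply: int_bound => // z /andP[_].
    rewrite le_eqVlt => /orP[/eqP ->|z0]; first by rewrite kernel0 normr0.
    by rewrite K0// normr0.
  by rewrite mul0r normr_le0 => /eqP ->; rewrite oppr0.
- move=> x y l e H; rewrite (_ : G y - G 0 - (G x - G 0) = G y - G x); last by ring.
  exact: Gs.
Qed.

(** The uniform continuity of [K] on the translated interval makes the expansion of [k1 (x + u)]
    uniform in [u]. *)
Lemma slope_under_hankel_op (k1 g : R -> R) a t : a <= t -> continuous g -> continuous k1 ->
  (forall x y l e, (forall z, `|z - x| <= `|y - x| -> `|K z - l| <= e) ->
     `|k1 y - k1 x - (y - x) * l| <= e * `|y - x|) ->
  forall x, has_slope (hankel_op k1 a t g) x (hankel_op K a t g x).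
Proof.
move=> at_ cg ck1 Hk x e e0; have [B [B0 HB]] := continuous_bounded a t cg.
have q0 : 0 < B * (t - a) + 1 by rewrite ltr_wpDl// mulr_ge0// subr_ge0.
have [d [d0 Hd]] := heine_cantor (x + a) (x + t) cK (divr_gt0 e0 q0).
exists d; split=> // y yx.
rewrite /hankel_op -(intB a t (continuous_hankel_integrand ck1 cg)
  (continuous_hankel_integrand ck1 cg)).
rewrite -(intZ a t (y - x) (continuous_hankel_integrand cK cg)).
have c1 : continuous (fun u => k1 (y + u) * g u - k1 (x + u) * g u).
  by move=> u; apply: cvgB; apply: continuous_hankel_integrand.
have c2 : continuous (fun u => (y - x) * (K (x + u) * g u)).
  by move=> u; apply: cvgM; [exact: cvg_cst|apply: continuous_hankel_integrand].
rewrite -(intB a t c1 c2).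
apply: (@le_trans _ _ (e / (B * (t - a) + 1) * `|y - x| * B * (t - a))).
  apply: int_bound => //; first by move=> u; apply: cvgB; [exact: c1|exact: c2].
  move=> u /andP[au ut]; rewrite -mulrBl mulrA -mulrBl normrM ler_pM// ?HB ?au//.
  have := Hk (x + u) (y + u) (K (x + u)) (e / (B * (t - a) + 1)).
  rewrite (_ : y + u - (x + u) = y - x); last by ring.
  apply => z zx; rewrite distrC Hd ?lerD2l ?au//.
  by rewrite distrC (le_lt_trans zx).
rewrite -!mulrA mulrCA [leLHS](_ : _ = e * `|y - x| * (B * (t - a) / (B * (t - a) + 1))); last by ring.
rewrite -[leRHS]mulr1 ler_wpM2l ?mulr_ge0 ?(ltW e0)//.
by rewrite ler_pdivrMr// mul1r lerDl.
Qed.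

(* [F x = 1 + c \int_x^t psi] satisfies [F + c K_t F = const], hence it is
   [Phi / Phi t]. *)
Lemma slope_in_space c t (Phi psi : R -> R) : 0 < t < T ->
  fredholm_det `]-oo, t[ (hankel K) c <> 0 ->
  continuous Phi ->
  (forall x, - T <= x <= T -> Phi x + c * Kop t Phi x = 1) ->
  continuous psi ->
  (forall x, - T <= x <= T -> psi x + - c * Kop t psi x = K (x + t)) ->
  Phi t <> 0 /\
  forall x, - T < x < t -> has_slope Phi x (- c * Phi t * psi x).
Proof.
move=> /andP[t0 tT] D0 cPhi ePhi cpsi epsi.
have tT' : 0 <= t < T by rewrite (ltW t0).
have TN0 : - T <= 0 by rewrite oppr_le0 ltW.
have Tt : - T <= t by rewrite (le_trans TN0)// ltW.
have [P [PE Ps]] := primitive cpsi.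
have slopeP x : has_slope P x (psi x).
  move=> e e0; have [d [d0 Hd]] := (continuousP_eps psi).1 cpsi x e e0.
  exists d; split=> // y yx; apply: Ps => z zx.
  by rewrite distrC Hd// distrC (le_lt_trans zx).
have cP : continuous P by apply: has_slope_continuous => x; exists (psi x).
have [k1 [ck1 sk1 k10 Hk1]] := primitive_kernel.
pose F x := 1 + c * (P t - P x).
have cF : continuous F.
  move=> x; apply: cvgD; first exact: cvg_cst.
  by apply: cvgM; [exact: cvg_cst|apply: cvgB; [exact: cvg_cst|exact: cP]].
have slopeF x : has_slope F x (- c * psi x).
  rewrite (_ : F = fun x => (1 + c * P t) + - c * P x); last first.
    by apply/funext => y; rewrite /F; ring.
  by rewrite -[- c * psi x]add0r; apply: has_slopeD (has_slope_cst _ _) (has_slopeZ _ (slopeP x)).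
(* Integration by parts of [Kop t F]: the boundary term at [t] is [k1 (x + t)] because [F t = 1],
   and the one at [- T] vanishes because [k1] is 0 at [x - T <= 0]. *)
pose W x := k1 (x + t) + c * hankel_op k1 (- T) t psi x.
have KF x : - T <= x <= T -> Kop t F x = W x.
  move=> /andP[_ xT].
  have cc : continuous (fun y => - c * psi y).
    by move=> y; apply: cvgM; [exact: cvg_cst|exact: cpsi].
  have cg : continuous (fun y => K (x + y) * F y + k1 (x + y) * (- c * psi y)).
    move=> y; apply: cvgD; first exact: continuous_hankel_integrand.
    exact: (continuous_hankel_integrand ck1 cc).
  have sg y : has_slope (fun y => k1 (x + y) * F y) y
      (K (x + y) * F y + k1 (x + y) * (- c * psi y)).
    have := has_slopeM (has_slope_shift (sk1 (x + y))) (slopeF y); apply.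
  have := slope_FTC cg sg Tt.
  rewrite (intD (- T) t (continuous_hankel_integrand cK cF) (continuous_hankel_integrand ck1 cc)).
  have -> : F t = 1 by rewrite /F subrr mulr0 addr0.
  rewrite (k10 (x - T)) ?mul0r ?subr0 ?mulr1 ?subr_le0// => H.
  have : Kop t F x + hankel_op k1 (- T) t (fun y => - c * psi y) x = k1 (x + t) by [].
  by rewrite hankel_opZ// /W => <-; ring.
have sW x : has_slope W x (K (x + t) + c * Kop t psi x).
  apply: has_slopeD; last exact/has_slopeZ/slope_under_hankel_op.
  rewrite (_ : (fun x => k1 (x + t)) = fun x => k1 (t + x)); last first.
    by apply/funext => y; rewrite addrC.
  by rewrite addrC; exact: has_slope_shift.
(* The slope of [W] is [K (x + t) + c * Kop t psi x], which is [psi x] by the equation for [psi];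
   and [W (- T) = 0]. *)
have Wpsi x : - T <= x <= T -> W x = P x - P (- T).
  move=> /andP[Tx xT].
  have cw : continuous (fun x => K (x + t) + c * Kop t psi x).
    move=> y; apply: cvgD.
      apply: (@continuous_comp _ _ _ (fun y => y + t) K); last exact: cK.
      by apply: cvgD; [exact: cvg_id|exact: cvg_cst].
    by apply: cvgM; [exact: cvg_cst|exact: continuous_hankel_op].
  have := slope_FTC cw sW Tx.
  have -> : W (- T) = 0.
    rewrite /W k10 ?add0r; last by rewrite addrC subr_le0 ltW.
    rewrite /hankel_op (@eq_int _ _ (fun=> 0)) ?Rintegral_cst ?mul0r ?mulr0//.
    move=> y /andP[_ yt]; rewrite k10 ?mul0r// addrC subr_le0.
    by rewrite (le_trans yt)// ltW.
  rewrite subr0 => <-; rewrite PE//; apply: eq_int => z /andP[Tz zx].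
  have zT : - T <= z <= T by rewrite Tz (le_trans zx).
  by rewrite -(epsi z zT); ring.
pose q := 1 + c * (P t - P (- T)).
have FE x : - T <= x <= T -> F x + c * Kop t F x = q.
  by move=> xT; rewrite KF// Wpsi// /F /q; ring.
have FPhi x : - T <= x <= t -> F x = q * Phi x.
  move=> xt; apply/eqP; rewrite -subr_eq0; apply/eqP.
  have c1 : continuous (fun x => - q * Phi x).
    by move=> y; apply: cvgM; [exact: cvg_cst|exact: cPhi].
  have c2 : continuous (fun x => F x - q * Phi x).
    by move=> y; apply: cvgB; [exact: cF|apply: cvgM; [exact: cvg_cst|exact: cPhi]].
  refine (hankel_op_inj cK K0 tT' D0 c2 _ xt) => {x xt} x /andP[Tx xt].
  have xT : - T <= x <= T by rewrite Tx (le_trans xt)// ltW.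
  rewrite (_ : (fun x => F x - q * Phi x) = fun x => F x + - q * Phi x); last first.
    by apply/funext => y; rewrite mulNr.
  rewrite hankel_opD// hankel_opZ//.
  have e1 := FE x xT; have e2 := ePhi x xT; move: e1 e2.
  move: (F x) (Kop t F x) (Phi x) (Kop t Phi x) => a1 b1 a2 b2 e1 e2.
  transitivity (a1 + c * b1 - q * (a2 + c * b2)); first by ring.
  by rewrite e1 e2 mulr1 subrr.
(* [F] is 1 at [t] by construction, which both shows [Phi t <> 0] and identifies [q] as its
   inverse. *)
have qPhi : q * Phi t = 1.
  by rewrite -FPhi ?Tt ?lexx// /F subrr mulr0 addr0.
have Phit0 : Phi t != 0.
  by apply: contra_eq_neq qPhi => ->; rewrite mulr0 eq_sym oner_eq0.
split; first exact/eqP.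
move=> x /andP[Tx xt] e e0.
have PhiE y : - T <= y <= t -> Phi y = Phi t * F y.
  by move=> yt; rewrite FPhi// mulrA [Phi t * q]mulrC qPhi mul1r.
have cp0 : 0 < `|c * Phi t| + 1 by rewrite ltr_wpDl.
have [d [d0 Hd]] := slopeP x _ (divr_gt0 e0 cp0).
exists (Num.min d (Num.min (x + T) (t - x))); split.
  by rewrite !lt_min d0 subr_gt0 xt andbT -ltrBlDr sub0r.
move=> y; rewrite !lt_min => /andP[yd /andP[yT yt]].
have yTt : - T <= y <= t.
  move: yT yt; rewrite !ltr_norml => /andP[+ _] /andP[_ +].
  by rewrite ltrD2r ltrBrDr opprD addrAC addNr add0r => /ltW -> /ltW ->.
have xTt : - T <= x <= t by rewrite !ltW.
rewrite (PhiE y yTt) (PhiE x xTt) /F.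
rewrite (_ : _ - _ = - (c * Phi t) * (P y - P x - (y - x) * psi x)); last by ring.
rewrite normrM normrN; apply: le_trans (ler_wpM2l (normr_ge0 _) (Hd y yd)) _.
rewrite mulrA ler_wpM2r// mulrCA -[leRHS]mulr1 ler_wpM2l ?(ltW e0)//.
by rewrite ler_pdivrMr// mul1r lerDl.
Qed.

End SpaceDerivative.

(** * Continuous representatives of the L2 solutions *)

Section Representatives.
Variable R : realType.
Notation mu := (@lebesgue_measure R).
Variables (K : R -> R) (T : R).
Hypotheses (cK : continuous K) (K0 : forall x, x < 0 -> K x = 0) (T0 : 0 < T).
Implicit Types (f g : R -> R) (c x y t s : R).

Local Notation Kop := (hankel_op K (- T)).

Lemma ae_imply (P Q : R -> Prop) : (forall x, P x -> Q x) ->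
  {ae mu, forall x, P x} -> {ae mu, forall x, Q x}.
Proof. exact: (@filterS _ _ (ae_filter_ringOfSetsType mu)). Qed.

Lemma ae_imply2 (P Q S : R -> Prop) : (forall x, P x -> Q x -> S x) ->
  {ae mu, forall x, P x} -> {ae mu, forall x, Q x} -> {ae mu, forall x, S x}.
Proof. exact: (@filterS2 _ _ (ae_filter_ringOfSetsType mu)). Qed.

(** The interval is bounded and [|f| <= 1 + f ^+ 2]. *)
Lemma integrable_of_L2 t f : in_L2 `]-oo, t[ f ->
  mu.-integrable `[- T, t] (EFin \o (f \_ `]-oo, t[)).
Proof.
move=> [mf f2]; set f0 := f \_ _.
have mf0 : measurable_fun setT f0.
  by apply: (measurable_restrictT f _).1 => //.
have i2 : mu.-integrable `[- T, t] (EFin \o (fun y => f0 y ^+ 2)).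
  apply: (@integrableS _ _ _ _ setT) => //.
  rewrite (_ : _ \o _ = (EFin \o (fun y => f y ^+ 2)) \_ `]-oo, t[); last first.
    apply/funext => y; rewrite /f0 /= !patchE; case: ifP => // _.
    by rewrite expr0n.
  have := @integrable_mkcond _ _ R mu `]-oo, t[%classic (EFin \o (fun y => f y ^+ 2)) (measurable_itv _).
  move=> [+ _]; apply.
  apply/integrableP; split.
    by apply/measurable_EFinP; exact: measurable_funX.
  by under eq_integral do rewrite /= ger0_norm ?sqr_ge0//.
have i1 : mu.-integrable `[- T, t] (EFin \o (fun y => 1 + f0 y ^+ 2)).
  have ic : mu.-integrable `[- T, t] (EFin \o (fun=> 1 : R)).
    by apply: continuous_integrable => y; exact: cvg_cst.
  by apply: integrableD ic i2.
apply: le_integrable i1 => //.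
  by apply/measurable_EFinP; exact: measurable_funTS.
move=> y _; rewrite /= lee_fin [leRHS]ger0_norm ?addr_ge0 ?sqr_ge0//.
rewrite -[X in 1 + X]real_normK ?num_real//.
have [h|h] := leP `|f0 y| 1; first by rewrite (le_trans h)// lerDl sqr_ge0.
by rewrite (@le_trans _ _ (`|f0 y| ^+ 2))// ?lerDr// expr2 ler_peMl// ltW.
Qed.

Lemma integral_op_restrict t f x : x <= T ->
  integral_op `]-oo, t[ (hankel K) f x = Kop t (f \_ `]-oo, t[) x.
Proof.
move=> xT; rewrite /integral_op /hankel_op Rintegral_mkcond [RHS]Rintegral_mkcond.
congr (Rintegral _ _ _); apply/funext => y; rewrite !patchE /hankel.
have -> : (y \in `]-oo, t[%classic) = (y < t) by apply/idP/idP; rewrite inE/= in_itv.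
have -> : (y \in `[- T, t]%classic) = (- T <= y <= t) by apply/idP/idP; rewrite inE/= in_itv.
have [yt|ty] := ltP y t; last by case: ifP => // _; rewrite mulr0.
rewrite (ltW yt) andbT; have [//|yT] := leP (- T) y.
by rewrite K0 ?mul0r// -(subrr T) ler_ltD.
Qed.

Lemma measurable_hankel_integrand f x t : measurable_fun `[- T, t] f ->
  measurable_fun `[- T, t] (fun y => (K (x + y) * f y)%:E).
Proof.
move=> mf; apply/measurable_EFinP; apply: measurable_funM => //.
apply: measurable_funTS; apply: continuous_measurable_fun => y.
apply: (@continuous_comp _ _ _ (fun y => x + y) K); last exact: cK.
by apply: cvgD; [exact: cvg_cst|exact: cvg_id].
Qed.

(** The hypothesis compares products with the kernel, so [f] and [g] may differ where [K (x + y)]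
    vanishes; this allows one to ignore the jump at [- t]. *)
Lemma ae_eq_hankel_op t f g x : measurable_fun `]-oo, t[ f -> continuous g ->
  ae_eq_on `]-oo, t[ (fun y => K (x + y) * f y) (fun y => K (x + y) * g y) ->
  Kop t (f \_ `]-oo, t[) x = Kop t g x.
Proof.
move=> mf cg fg; rewrite /hankel_op /Rintegral; congr fine.
apply: ae_eq_integral => //.
- apply: measurable_hankel_integrand; apply: measurable_funTS.
  by apply: (measurable_restrictT f _).1 => //.
- apply: measurable_hankel_integrand; apply: measurable_funTS.
  exact: continuous_measurable_fun.
have nt : {ae mu, forall y, y <> t}.
  exists [set t]; split => //; first exact: lebesgue_measure_set1.
  by move=> y /= /contrapT.
apply: ae_imply2 fg nt => y fgy nty /=; rewrite in_itv/= => /andP[_ yt].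
have yt' : `]-oo, t[%classic y by rewrite /= in_itv/= lt_neqAle yt andbT; apply/eqP.
by rewrite patchE mem_set// fgy.
Qed.

Lemma kernel_continuous_shift t : continuous (fun x => K (x + t)).
Proof.
move=> y; apply: (@continuous_comp _ _ _ (fun y => y + t) K); last exact: cK.
by apply: cvgD; [exact: cvg_id|exact: cvg_cst].
Qed.

(** The equation itself expresses [f] almost everywhere through its continuous image under the
    operator. The same formula extends the solution beyond [t]. *)
Lemma L2_solution_kernel c t f : 0 <= t < T ->
  L2_solution `]-oo, t[ (hankel K) c (fun x => K (x + t)) f ->
  exists g, [/\ continuous g, ae_eq_on `]-oo, t[ f g,
    (forall x, - T <= x <= T -> g x + c * Kop t g x = K (x + t)) &
    forall x, x < - t -> g x = 0].
Proof.
move=> /andP[t0 tT] [L2f fE]; have [mf _] := L2f.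
pose V := Kop t (f \_ `]-oo, t[).
have cV : continuous V.
  by apply: continuous_hankel_op_integrable => //; exact: integrable_of_L2.
pose g x := K (x + t) - c * V x.
have cg : continuous g.
  move=> x; apply: cvgB; first exact: kernel_continuous_shift.
  by apply: cvgM; [exact: cvg_cst|exact: cV].
have fg : ae_eq_on `]-oo, t[ f g.
  apply: ae_imply fE => x H xt; have xt' : x < t by move: xt; rewrite /= in_itv.
  rewrite /g -(H xt) integral_op_restrict ?addrK// ltW//; exact: lt_trans xt' tT.
exists g; split => //.
- move=> x xT; rewrite -(@ae_eq_hankel_op t f g x)//; first by rewrite /g /V subrK.
  by apply: ae_imply fg => y H yt; rewrite H.
move=> x xt; rewrite /g K0; last by rewrite -ltrBrDr sub0r.
rewrite /V /hankel_op (@eq_int _ _ (fun=> 0)) ?Rintegral_cst ?mul0r ?mulr0 ?subr0//.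
move=> y /andP[_ yt]; rewrite K0 ?mul0r//.
by rewrite (le_lt_trans (lerD (lexx x) yt))// -ltrBrDr sub0r.
Qed.

(** The solution is 0 below [- t], whereas the equation with right-hand side 1 has the value 1
    there. For [x <= t] neither value is seen by the integral, so [f] is the cut of a continuous
    solution. *)
Lemma L2_solution_indicator c t f : 0 <= t < T ->
  L2_solution `]-oo, t[ (hankel K) c \1_(`[- t, t]) f ->
  exists g, [/\ continuous g,
    ae_eq_on `]-oo, t[ f (fun x => if x < - t then 0 else g x) &
    forall x, - T <= x <= T -> g x + c * Kop t g x = 1].
Proof.
move=> /andP[t0 tT] [L2f fE]; have [mf _] := L2f.
pose V := Kop t (f \_ `]-oo, t[).
have cV : continuous V.
  by apply: continuous_hankel_op_integrable => //; exact: integrable_of_L2.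
pose g0 x := 1 - c * V x.
have cg0 : continuous g0.
  move=> x; apply: cvgB; first exact: cvg_cst.
  by apply: cvgM; [exact: cvg_cst|exact: cV].
have V0 x : x < - t -> V x = 0.
  move=> xt; rewrite /V /hankel_op (@eq_int _ _ (fun=> 0)) ?Rintegral_cst ?mul0r//.
  move=> y /andP[_ yt]; rewrite K0 ?mul0r//.
  by rewrite (le_lt_trans (lerD (lexx x) yt))// -ltrBrDr sub0r.
have fg : ae_eq_on `]-oo, t[ f (fun x => if x < - t then 0 else g0 x).
  apply: ae_imply fE => x H xt; have xt' : x < t by move: xt; rewrite /= in_itv.
  move: (H xt); rewrite integral_op_restrict; last by rewrite ltW//; exact: lt_trans xt' tT.
  rewrite -/(V x) indicE; case: ltP => xNt.
    rewrite V0// mulr0 addr0 memNset//= in_itv/= => /andP[].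
    by rewrite leNgt xNt.
  by rewrite mem_set/= ?in_itv/= ?xNt ?(ltW xt')// => /(canRL (addrK _)) ->.
have VK x : x <= t -> V x = Kop t g0 x.
  move=> xt; apply: ae_eq_hankel_op => //.
  apply: ae_imply fg => y H yt; rewrite H//; case: ifP => // yNt.
  rewrite K0 ?mul0r//; apply: le_lt_trans (lerD xt (lexx y)) _.
  by rewrite addrC -ltrBrDr sub0r.
(* For [x > t] the integrals of [f] and of [g0] may differ, since [f] is 0 and [g0] is 1 below
   [- t]. Integrating [g0] makes the equation hold up to [T]. *)
pose g x := 1 - c * Kop t g0 x.
have cg : continuous g.
  move=> x; apply: cvgB; first exact: cvg_cst.
  by apply: cvgM; [exact: cvg_cst|exact: continuous_hankel_op].
have gg0 x : x <= t -> g x = g0 x by move=> xt; rewrite /g /g0 VK.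
exists g; split => //.
  apply: ae_imply fg => x H xt; rewrite H//; case: ifP => // _.
  by rewrite gg0// ltW//; move: xt; rewrite /= in_itv.
move=> x _; have -> : Kop t g x = Kop t g0 x.
  by apply: eq_int => y /andP[_ yt]; rewrite gg0.
exact: subrK.
Qed.

End Representatives.

(** * Slopes of representatives with a jump *)

Section HasSlope.
Variable R : realType.
Implicit Types (f g : R -> R) (x l : R).

Lemma has_slope_near f g x l (d : R) : 0 < d ->
  (forall y, `|y - x| < d -> f y = g y) -> has_slope f x l -> has_slope g x l.
Proof.
move=> d0 fg H e /H[d' [d'0 Hd]]; exists (Num.min d d').
split; first by rewrite lt_min d0.
move=> y; rewrite lt_min => /andP[yd yd']; rewrite -!fg ?subrr ?normr0//.
exact: Hd.
Qed.

Lemma has_slope_derive1 f x l : has_slope f x l ->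
  derivable f x 1 /\ derive1 f x = l.
Proof.
move=> /has_slope_is_derive H; split; first by apply: ex_derive.
by rewrite derive1E derive_val.
Qed.

End HasSlope.

Section JumpRepresentative.
Variable R : realType.
Implicit Types (G : R -> R -> R) (g : R -> R) (t x l : R).

(** Restores the jump of the indicator of [[- t, t]] at its left end; the right end is outside the
    domain. *)
Definition cut_below t g x := if x < - t then 0 else g x.

Lemma cut_below_continuous_left t g :
  {within `]-oo, - t[, continuous (cut_below t g)}.
Proof.
apply: (@subspace_eq_continuous _ _ _ (fun=> 0)); last first.
  by apply: continuous_subspaceT => x; exact: cvg_cst.
by move=> x; rewrite inE/= in_itv/= => xt; rewrite /from_subspace /cut_below ifT.
Qed.

Lemma cut_below_continuous_right t g : continuous g ->
  {within `[- t, t[, continuous (cut_below t g)}.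
Proof.
move=> cg; apply: (@subspace_eq_continuous _ _ _ g); last exact: continuous_subspaceT.
by move=> x; rewrite inE/= in_itv/= => /andP[tx _]; rewrite /from_subspace /cut_below ltNge tx.
Qed.

Lemma cvg_cut_below t g : 0 < t -> continuous g ->
  cut_below t g x @[x --> t^'-] --> g t.
Proof.
move=> t0 cg; have gt : g x @[x --> t^'-] --> g t.
  by apply: cvg_at_left_filter; exact: cg.
apply: cvg_trans gt; apply: near_eq_cvg; near=> x.
rewrite /cut_below ltNge ltW//; near: x; apply: nbhs_left_gt.
by rewrite (lt_trans _ t0)// oppr_lt0.
Unshelve. all: by end_near. Qed.

Lemma left_lim_cut_below t g : 0 < t -> continuous g ->
  cvg (cut_below t g x @[x --> t^'-]) /\ left_lim (cut_below t g) t = g t.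
Proof.
move=> t0 cg; have H := cvg_cut_below t0 cg; split; first exact: cvgP H.
exact: cvg_lim H.
Qed.

Lemma cut_below_slope_space t g x l : x <> - t ->
  (- t < x -> has_slope g x l) -> (x < - t -> l = 0) ->
  has_slope (cut_below t g) x l.
Proof.
move=> xt Hg Hl; have [xNt|xNt|//] := ltgtP x (- t).
  rewrite (Hl xNt); apply: (has_slope_near (f := fun=> 0) (d := - t - x)).
  - by rewrite subr_gt0.
  - move=> y; rewrite ltr_norml => /andP[_]; rewrite ltrD2r => yt.
    by rewrite /cut_below yt.
  - exact: has_slope_cst.
apply: (has_slope_near (f := g) (d := x + t)); last exact: Hg.
- by rewrite -ltrBlDr sub0r.
move=> y; rewrite ltr_norml => /andP[+ _]; rewrite opprD ltrBrDr addrAC addNr add0r => yt.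
by rewrite /cut_below ltNge ltW.
Qed.

(** The jump moves with [s], but for [x <> - t] the point [x] stays on the same side of [- s] when
    [s] is near [t]. *)
Lemma cut_below_slope_time t G x l : x <> - t ->
  (- t < x -> has_slope (fun s => G s x) t l) -> (x < - t -> l = 0) ->
  has_slope (fun s => cut_below s (G s) x) t l.
Proof.
move=> xt Hg Hl; have [xNt|xNt|//] := ltgtP x (- t).
  rewrite (Hl xNt); apply: (has_slope_near (f := fun=> 0) (d := - t - x)).
  - by rewrite subr_gt0.
  - move=> y; rewrite ltr_norml => /andP[_]; rewrite ltrBlDr addrAC addNr add0r => yt.
    by rewrite /cut_below ltrNr yt.
  - exact: has_slope_cst.
apply: (has_slope_near (f := fun s => G s x) (d := x + t)); last exact: Hg.
- by rewrite -ltrBlDr sub0r.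
move=> y; rewrite ltr_norml => /andP[+ _]; rewrite opprD ltrD2r => yt.
by rewrite /cut_below ltNge ltW// ltrNl.
Qed.

End JumpRepresentative.

(** * Continuous families of solutions and their derivatives for a factor c *)

Section Representation.
Variables (R : realType) (K : R -> R) (T : R).
Hypotheses (cK : continuous K) (K0 : forall x, x < 0 -> K x = 0) (T0 : 0 < T).

Lemma continuous_solutions_kernel c (phi : R -> R -> R) :
  (forall t, 0 <= t < T ->
     L2_solution `]-oo, t[ (hankel K) c (fun x => K (x + t)) (phi t)) ->
  exists g : R -> R -> R, forall t, 0 <= t < T ->
    [/\ continuous (g t), ae_eq_on `]-oo, t[ (phi t) (g t),
      (forall x, - T <= x <= T -> g t x + c * hankel_op K (- T) t (g t) x = K (x + t)) &
      forall x, x < - t -> g t x = 0].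
Proof.
move=> H; have /choice[g Hg] : forall t, exists g, 0 <= t < T ->
    [/\ continuous g, ae_eq_on `]-oo, t[ (phi t) g,
      (forall x, - T <= x <= T -> g x + c * hankel_op K (- T) t g x = K (x + t)) &
      forall x, x < - t -> g x = 0].
  move=> t; have [tT|] := boolP (0 <= t < T); last by exists (fun=> 0).
  by have [g Hg] := L2_solution_kernel cK K0 tT (H t tT); exists g.
by exists g.
Qed.

Lemma continuous_solutions_indicator c (Phi : R -> R -> R) :
  (forall t, 0 <= t < T ->
     L2_solution `]-oo, t[ (hankel K) c \1_(`[- t, t]) (Phi t)) ->
  exists g : R -> R -> R, forall t, 0 <= t < T ->
    [/\ continuous (g t), ae_eq_on `]-oo, t[ (Phi t) (cut_below t (g t)) &
      forall x, - T <= x <= T -> g t x + c * hankel_op K (- T) t (g t) x = 1].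
Proof.
move=> H; have /choice[g Hg] : forall t, exists g, 0 <= t < T ->
    [/\ continuous g, ae_eq_on `]-oo, t[ (Phi t) (cut_below t g) &
      forall x, - T <= x <= T -> g x + c * hankel_op K (- T) t g x = 1].
  move=> t; have [tT|] := boolP (0 <= t < T); last by exists (fun=> 0).
  by have [g Hg] := L2_solution_indicator cK K0 tT (H t tT); exists g.
by exists g.
Qed.

(** Stated for a general [c] so that it serves twice: replacing [c] by [- c] exchanges Phi with Psi
    and [phi] with [psi]. Left of [- t], where the cut function is 0, the formulas hold because
    [phi] and [psi] vanish there. *)
Lemma hankel_derivatives c (Phi phi psi : R -> R -> R) :
  (forall t, 0 <= t < T -> fredholm_det `]-oo, t[ (hankel K) c <> 0) ->
  (forall t, 0 <= t < T -> continuous (Phi t) /\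
    forall x, - T <= x <= T -> Phi t x + c * hankel_op K (- T) t (Phi t) x = 1) ->
  (forall t, 0 <= t < T -> [/\ continuous (phi t),
    (forall x, - T <= x <= T -> phi t x + c * hankel_op K (- T) t (phi t) x = K (x + t)) &
    forall x, x < - t -> phi t x = 0]) ->
  (forall t, 0 <= t < T -> [/\ continuous (psi t),
    (forall x, - T <= x <= T -> psi t x + - c * hankel_op K (- T) t (psi t) x = K (x + t)) &
    forall x, x < - t -> psi t x = 0]) ->
  forall t, 0 < t < T ->
  [/\ Phi t t <> 0,
    fredholm_det `]-oo, t[ (hankel K) c * Phi t t =
      fredholm_det `]-oo, t[ (hankel K) (- c) &
    forall x, x < t -> x <> - t ->
      has_slope (fun s => cut_below s (Phi s) x) t (- c * Phi t t * phi t x) /\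
      has_slope (cut_below t (Phi t)) x (- c * Phi t t * psi t x)].
Proof.
move=> D0 HPhi Hphi Hpsi t tT; have [t0 tT'] := andP tT.
have tT0 : 0 <= t < T by rewrite (ltW t0).
have [cPhi ePhi] := HPhi t tT0.
have [cphi ephi phi0] := Hphi t tT0; have [cpsi epsi psi0] := Hpsi t tT0.
have TN0 : - T < 0 by rewrite oppr_lt0.
have NTt : - T < - t by rewrite ltrN2.
have [Phit0 Hsp] := slope_in_space cK K0 T0 tT (D0 t tT0) cPhi ePhi cpsi epsi.
split => //.
  apply: (@fredholm_det_ratio R K c (- T) t (Phi t)) => //.
  - exact: lt_trans TN0 t0.
  - by rewrite addrC subr_lt0.
  by move=> x /andP[Tx xt]; apply: ePhi; rewrite Tx (le_trans xt)// ltW.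
move=> x xt xNt; split.
  apply: cut_below_slope_time => // [tx|tx]; last by rewrite phi0// mulr0.
  apply: (slope_in_upper_end cK K0 T0 tT (D0 t tT0)) => //.
  - by move=> s /HPhi[].
  - by move=> s /HPhi[].
  by rewrite ltW ?(lt_trans NTt)//= ltW// (lt_trans xt).
apply: cut_below_slope_space => // [tx|tx]; last by rewrite psi0// mulr0.
by apply: Hsp; rewrite (lt_trans NTt).
Qed.

End Representation.

Theorem theorem1 (R : realType) (xi : R[i] -> R[i]) (hxi : is_riemann_xi xi)
    (omega : R) (nu : nat) (homega : 0 < omega) (hnu : (0 < nu)%N)
    (homeganu : 1 < omega * nu%:R)
    (K : R -> R) (hK : kernel_regular K) (hKxi : fourier_formula xi omega nu K)
    (tau : R) (htau : 0 < tau)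
    (hdet : forall t : R, 0 <= t < tau ->
       fredholm_det `]-oo, t[ (hankel K) 1 <> 0 /\
       fredholm_det `]-oo, t[ (hankel K) (-1) <> 0)
    (phip phim Phi Psi : R -> R -> R)
    (hphip : forall t : R, 0 <= t < tau ->
       L2_solution `]-oo, t[ (hankel K) 1 (fun x => K (x + t)) (phip t))
    (hphim : forall t : R, 0 <= t < tau ->
       L2_solution `]-oo, t[ (hankel K) (-1) (fun x => K (x + t)) (phim t))
    (hPhi : forall t : R, 0 <= t < tau ->
       L2_solution `]-oo, t[ (hankel K) 1 \1_(`[- t, t]) (Phi t))
    (hPsi : forall t : R, 0 <= t < tau ->
       L2_solution `]-oo, t[ (hankel K) (-1) \1_(`[- t, t]) (Psi t))
    (m : R -> R)
    (hm : forall t : R, 0 <= t < tau ->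
       m t = fredholm_det `]-oo, t[ (hankel K) 1 /
             fredholm_det `]-oo, t[ (hankel K) (-1)) :
  exists phip' phim' Phi' Psi' : R -> R -> R,
  [/\ (* the L^2-classes are represented by continuous functions; those of
         Phi(t,.) and Psi(t,.) have a jump at x = -t, as 1_[-t,t] does *)
      (forall t : R, 0 <= t < tau ->
         [/\ ae_eq_on `]-oo, t[ (phip t) (phip' t) /\
               {within `]-oo, t[, continuous (phip' t)},
             ae_eq_on `]-oo, t[ (phim t) (phim' t) /\
               {within `]-oo, t[, continuous (phim' t)},
             [/\ ae_eq_on `]-oo, t[ (Phi t) (Phi' t),
                 {within `]-oo, (- t)[, continuous (Phi' t)} &
                 {within `[- t, t[, continuous (Phi' t)}] &
             [/\ ae_eq_on `]-oo, t[ (Psi t) (Psi' t),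
                 {within `]-oo, (- t)[, continuous (Psi' t)} &
                 {within `[- t, t[, continuous (Psi' t)}]]),
      (forall t : R, 0 < t < tau ->
         [/\ cvg (Phi' t x @[x --> t^'-]), left_lim (Phi' t) t <> 0,
             cvg (Psi' t x @[x --> t^'-]) & left_lim (Psi' t) t <> 0]),
      (forall t x : R, 0 < t < tau -> x < t -> x <> - t ->
         [/\ derivable (fun s => Phi' s x) t 1 /\
               phip' t x = - (left_lim (Phi' t) t)^-1 *
                           derive1 (fun s => Phi' s x) t,
             derivable (Psi' t) x 1 /\
               phip' t x = (left_lim (Psi' t) t)^-1 * derive1 (Psi' t) x,
             derivable (Phi' t) x 1 /\
               phim' t x = - (left_lim (Phi' t) t)^-1 * derive1 (Phi' t) x &
             derivable (fun s => Psi' s x) t 1 /\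
               phim' t x = (left_lim (Psi' t) t)^-1 *
                           derive1 (fun s => Psi' s x) t]) &
      (forall t : R, 0 < t < tau ->
         m t = (left_lim (Phi' t) t)^-1 /\ m t = left_lim (Psi' t) t)].

Proof.
have [cK K0 _ _ _] := hK.
have [phip' Hphip] := continuous_solutions_kernel cK K0 hphip.
have [phim' Hphim] := continuous_solutions_kernel cK K0 hphim.
have [G HG] := continuous_solutions_indicator cK K0 hPhi.
have [H HH] := continuous_solutions_indicator cK K0 hPsi.
have HPhi := @hankel_derivatives R K tau cK K0 htau 1 G phip' phim'.
have HPsi := @hankel_derivatives R K tau cK K0 htau (-1) H phim' phip'.
rewrite opprK in HPsi.
have gp t (tT : 0 <= t < tau) : [/\ continuous (phip' t),
    (forall x, - tau <= x <= tau ->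
       phip' t x + 1 * hankel_op K (- tau) t (phip' t) x = K (x + t)) &
    forall x, x < - t -> phip' t x = 0] by have [] := Hphip t tT.
have gm t (tT : 0 <= t < tau) : [/\ continuous (phim' t),
    (forall x, - tau <= x <= tau ->
       phim' t x + -1 * hankel_op K (- tau) t (phim' t) x = K (x + t)) &
    forall x, x < - t -> phim' t x = 0] by have [] := Hphim t tT.
have gG t (tT : 0 <= t < tau) : continuous (G t) /\ forall x, - tau <= x <= tau ->
    G t x + 1 * hankel_op K (- tau) t (G t) x = 1 by have [] := HG t tT.
have gH t (tT : 0 <= t < tau) : continuous (H t) /\ forall x, - tau <= x <= tau ->
    H t x + -1 * hankel_op K (- tau) t (H t) x = 1 by have [] := HH t tT.
have {}HPhi := HPhi (fun t tT => proj1 (hdet t tT)) gG gp gm.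
have {}HPsi := HPsi (fun t tT => proj2 (hdet t tT)) gH gm gp.
exists phip', phim', (fun t => cut_below t (G t)), (fun t => cut_below t (H t)).
have limG t : 0 < t < tau -> cvg (cut_below t (G t) x @[x --> t^'-]) /\
    left_lim (cut_below t (G t)) t = G t t.
  move=> /andP[t0 tT]; apply: left_lim_cut_below => //.
  by have [] := HG t _; rewrite // (ltW t0).
have limH t : 0 < t < tau -> cvg (cut_below t (H t) x @[x --> t^'-]) /\
    left_lim (cut_below t (H t)) t = H t t.
  move=> /andP[t0 tT]; apply: left_lim_cut_below => //.
  by have [] := HH t _; rewrite // (ltW t0).
split.
- move=> t tT.
  have [cp ep _ _] := Hphip t tT; have [cm em _ _] := Hphim t tT.
  have [cG eG _] := HG t tT; have [cH eH _] := HH t tT.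
  split.
  + by split => //; exact: continuous_subspaceT.
  + by split => //; exact: continuous_subspaceT.
  + split => //; first exact: cut_below_continuous_left.
    exact: cut_below_continuous_right.
  + split => //; first exact: cut_below_continuous_left.
    exact: cut_below_continuous_right.
- move=> t tT; have [G0 _ _] := HPhi t tT; have [H0 _ _] := HPsi t tT.
  by have [? ->] := limG t tT; have [? ->] := limH t tT.
- move=> t x tT xt xNt; have [/eqP G0 _ /(_ x xt xNt)] := HPhi t tT.
  move=> [/has_slope_derive1[d1 e1] /has_slope_derive1[d2 e2]].
  have [/eqP H0 _ /(_ x xt xNt)] := HPsi t tT.
  move=> [/has_slope_derive1[d3 e3] /has_slope_derive1[d4 e4]].
  have [_ ->] := limG t tT; have [_ ->] := limH t tT; rewrite e1 e2 e3 e4.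
  split.
  + split; first exact: d1.
    by rewrite !mulNr mul1r mulrN opprK mulKf.
  + split; first exact: d4.
    by rewrite mul1r mulKf.
  + split; first exact: d2.
    by rewrite !mulNr mul1r mulrN opprK mulKf.
  + split; first exact: d3.
    by rewrite mul1r mulKf.
move=> t tT; have [G0 eG _] := HPhi t tT; have [H0 eH _] := HPsi t tT.
have [_ ->] := limG t tT; have [_ ->] := limH t tT.
have tT0 : 0 <= t < tau by move: tT => /andP[/ltW -> ->].
rewrite hm//; have [/eqP D1 /eqP D2] := hdet t tT0; move/eqP: G0 => G0.
(* With [D1], [D2] the determinants for 1 and -1, [D1 * G t t = D2] and [D2 * H t t = D1], while
   [m t = D1 / D2]. *)
split; first by rewrite -eG; field; rewrite D1 G0.
by rewrite -eH; field; rewrite D2.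
Qed.
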